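(* Every $4$-web $MW$, i.e. every $4$-web with a nonconstant basic invariant and equal curvature forms of its $3$-subwebs, is linearizable.
   Context: Let $M^2$ be a two-dimensional analytic manifold. A $4$-web is given in an open domain $D\subset M^2$ by four foliations $X_1,X_2,X_3,X_4$ of curves such that the tangents to the curves of different foliations through any point of $D$ are distinct, and two curves of different foliations have at most one common point in $D$. All functions and forms are real of class $C^\infty$ (or holomorphic in the complex case). All considerations are local ($D$ may be shrunk around a point). The foliation $X_\alpha$, $\alpha=1,2,3$, is defined by $\omega_\alpha=0$, where the $1$-forms are normalized so that $\omega_1+\omega_2+\omega_3=0$. There is a unique $1$-form $\theta$ with $d\omega_\alpha=\omega_\alpha\wedge\theta$, and the curvature $K$ of the $3$-subweb $[1,2,3]$ is defined by $d\theta=K\,\omega_1\wedge\omega_2$. The foliation $X_4$ is defined by $\omega_4=0$, where $-\omega_4=a\omega_1+\omega_2$; the function $a\neq0,1$ is the basic invariant. Covariant derivatives of $a$ are defined by $da=a_1\omega_1+a_2\omega_2$, $da_1-a_1\theta=a_{11}\omega_1+a_{12}\omega_2$, $da_2-a_2\theta=a_{12}\omega_1+a_{22}\omega_2$. The curvature forms of the four $3$-subwebs ($[b,c,d]$ is formed by $X_b,X_c,X_d$) are $$\Theta_{[123]}=K\,\omega_1\wedge\omega_2,\qquad \Theta_{[124]}=\Bigl(K-\frac{a_{12}}{a}+\frac{a_1a_2}{a^2}\Bigr)\omega_1\wedge\omega_2,$$ $$\Theta_{[134]}=\Bigl[K+\frac{a_2(a_1-a_2)}{(1-a)^2}+\frac{a_{12}-a_{22}}{1-a}\Bigr]\omega_1\wedge\omega_2,$$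 $$\Theta_{[234]}=\Bigl[K+\frac{(2a-1)a_1(a_1-a_2)}{a^2(1-a)^2}+\frac{a_{11}-a_{12}}{a(1-a)}\Bigr]\omega_1\wedge\omega_2.$$ A $4$-web is a web $MW$ if its basic invariant is nonconstant ($a_1$ and $a_2$ do not vanish simultaneously) and these four curvature forms are equal. Two $4$-webs with domains $D,\widetilde D$ are equivalent if there is a diffeomorphism (respectively an analytic isomorphism) $\phi:D\to\widetilde D$ with $\phi(X_c)=\widetilde X_c$, $c=1,2,3,4$. A $4$-web is linear if it is formed by four foliations of straight lines, and linearizable if it is equivalent to a linear $4$-web. *)

(* Defs.v *)
From HB Require Import structures.
From mathcomp Require Import all_boot all_order all_algebra.
From mathcomp Require Import all_classical all_reals all_analysis.
From mathcomp Require Import complex.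

Set Implicit Arguments.
Unset Strict Implicit.
Unset Printing Implicit Defensive.

Import Order.TTheory GRing.Theory Num.Theory.
Import numFieldNormedType.Exports.

Local Open Scope classical_set_scope.
Local Open Scope ring_scope.

(* Everything is developed over a numFieldType F, to be instantiated with
   F := R (the real C^oo setting) and F := R[i] (the holomorphic setting),
   where R : realType. A web lives in a coordinate domain D of F^2. *)

Definition pt (F : numFieldType) : Type := (F * F)%type.

Section Calculus.
Variable F : numFieldType.
Implicit Types (D : set (pt F)) (f : pt F -> F).

Definition pd1 f : pt F -> F := fun p => 'D_((1, 0) : pt F) f p.
Definition pd2 f : pt F -> F := fun p => 'D_((0, 1) : pt F) f p.

(* Differentiability is over F: for F = R[i] it is complex differentiability
   and [smooth] is holomorphy. *)
Fixpoint Ck (n : nat) D f : Prop :=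
  match n with
  | 0%N => forall p, D p -> {for p, continuous f}
  | n'.+1 => [/\ forall p, D p -> differentiable f p,
                 Ck n' D (pd1 f) & Ck n' D (pd2 f)]
  end.

Definition smooth D f : Prop := forall n, Ck n D f.

Definition smooth_pair D (g : pt F -> pt F) : Prop :=
  smooth D (fun p => (g p).1) /\ smooth D (fun p => (g p).2).

(* A 1-form P dx + Q dy is the pair (P, Q) of its coefficients; a 2-form is
   its coefficient relative to dx /\ dy. *)
Definition form1 : Type := pt F -> pt F.
Definition form2 : Type := pt F -> F.
Implicit Types (w t : form1).

Definition ev w (p v : pt F) : F := (w p).1 * v.1 + (w p).2 * v.2.
Definition dfun f : form1 := fun p => (pd1 f p, pd2 f p).
Definition dform w : form2 :=
  fun p => pd1 (fun q => (w q).2) p - pd2 (fun q => (w q).1) p.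
Definition wedge w t : form2 :=
  fun p => (w p).1 * (t p).2 - (w p).2 * (t p).1.

Definition diffeomorphism (U V : set (pt F)) (phi : pt F -> pt F) : Prop :=
  exists psi : pt F -> pt F,
    [/\ smooth_pair U phi, smooth_pair V psi,
        (forall p, U p -> V (phi p)) /\ (forall q, V q -> U (psi q)),
        forall p, U p -> psi (phi p) = p
      & forall q, V q -> phi (psi q) = q].

End Calculus.

Section Foliations.
Variable F : numFieldType.
Implicit Types (D U V : set (pt F)) (p q v : pt F).

(* X p is the curve of the foliation through p; only p in the domain matters. *)
Definition foliation : Type := pt F -> set (pt F).
Implicit Type X : foliation.

Definition first_integral D X U (f : pt F -> F) : Prop :=
  [/\ open U, U `<=` D, smooth U f,
      forall p, U p -> dfun f p != 0
    & forall p q, U p -> U q -> (X p q <-> f p = f q)].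

(* Near each point the traces of the curves are the level sets of a submersion.
   That a curve leaves a single level set as its trace on a small neighbourhood
   is no restriction for webs: a curve returning to every neighbourhood of a
   point would meet a curve of another foliation of the web twice. *)
Record is_foliation D X : Prop := IsFoliation {
  fol_sub : forall p, D p -> X p `<=` D;
  fol_refl : forall p, D p -> X p p;
  fol_part : forall p q, D p -> X p q -> X q = X p;
  fol_conn : forall p, D p -> connected (X p);
  fol_loc : forall p, D p -> exists U f, U p /\ first_integral D X U f
}.

Definition tangent D X p v : Prop :=
  exists U f, [/\ U p, first_integral D X U f & ev (dfun f) p v = 0].

(* w = 0 defines X: the kernel of w at p is the tangent line at p of the curve
   through p. *)
Definition defined_by D X (w : form1 F) : Prop :=
  smooth_pair D w /\
  forall p, D p -> w p != 0 /\ forall v, tangent D X p v <-> ev w p v = 0.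

Definition restrict U X : foliation :=
  fun p => connected_component (X p `&` U) p.

Definition straight_line (L : set (pt F)) : Prop :=
  exists p v, v != 0 /\ L = [set p + t *: v | t in [set: F]].

Definition linear_foliation D X : Prop :=
  forall p, D p -> exists L, straight_line L /\ X p `<=` L.

End Foliations.

(* 'I_4 counts from 0, the foliations X_1, ..., X_4 from 1. *)
Definition ix1 : 'I_4 := @Ordinal 4 0 isT.
Definition ix2 : 'I_4 := @Ordinal 4 1 isT.
Definition ix3 : 'I_4 := @Ordinal 4 2 isT.
Definition ix4 : 'I_4 := @Ordinal 4 3 isT.

Section Webs.
Variable F : numFieldType.
Implicit Types (D U V : set (pt F)).

Definition web : Type := 'I_4 -> foliation F.
Implicit Types X Y : web.

Record is_web D X : Prop := IsWeb {
  web_open : open D;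
  web_conn : connected D;
  web_fol : forall c, is_foliation D (X c);
  web_tangent : forall c c' p v, c != c' -> D p ->
    tangent D (X c) p v -> tangent D (X c') p v -> v = 0;
  web_inter : forall c c' p q r s, c != c' -> D p -> D q ->
    (X c p `&` X c' q) r -> (X c p `&` X c' q) s -> r = s
}.

Definition restrict_web U X : web := fun c => restrict U (X c).

Definition equivalent D X (D' : set (pt F)) Y : Prop :=
  exists phi : pt F -> pt F,
    diffeomorphism D D' phi /\
    forall c p, D p -> phi @` X c p = Y c (phi p).

Definition linear_web D X : Prop := forall c, linear_foliation D (X c).

Definition linearizable D X : Prop :=
  exists (D' : set (pt F)) Y,
    [/\ is_web D' Y, linear_web D' Y & equivalent D X D' Y].

Definition locally_linearizable D X : Prop :=
  forall p, D p -> exists U,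
    [/\ open U, U p, U `<=` D, connected U & linearizable U (restrict_web U X)].

(* The normalized forms of the web, the connection form theta, the curvature K (curv)
   of the subweb [1,2,3], the basic invariant a (binv), and the covariant
   derivatives a_1, a_2, a_11, a_12, a_22 of a. *)
Record web_data : Type := WebData {
  omega : 'I_4 -> form1 F;
  theta : form1 F;
  curv : pt F -> F;
  binv : pt F -> F;
  binv1 : pt F -> F;
  binv2 : pt F -> F;
  binv11 : pt F -> F;
  binv12 : pt F -> F;
  binv22 : pt F -> F
}.

Record is_web_data D X (d : web_data) : Prop := IsWebData {
  wd_forms : forall c, defined_by D (X c) (omega d c);
  wd_norm : forall p, D p -> omega d ix1 p + omega d ix2 p + omega d ix3 p = 0;
  wd_theta_smooth : smooth_pair D (theta d);
  wd_theta : forall c p, c != ix4 -> D p ->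
    dform (omega d c) p = wedge (omega d c) (theta d) p;
  wd_K_smooth : smooth D (curv d);
  wd_K : forall p, D p ->
    dform (theta d) p = curv d p * wedge (omega d ix1) (omega d ix2) p;
  wd_a_smooth : smooth D (binv d);
  wd_a_neq : forall p, D p -> binv d p != 0 /\ binv d p != 1;
  wd_a : forall p, D p -> - omega d ix4 p = binv d p *: omega d ix1 p + omega d ix2 p;
  wd_a_cov1 : [/\ smooth D (binv1 d), smooth D (binv2 d) &
    forall p, D p ->
      dfun (binv d) p = binv1 d p *: omega d ix1 p + binv2 d p *: omega d ix2 p];
  wd_a_cov2 : [/\ smooth D (binv11 d), smooth D (binv12 d) & smooth D (binv22 d)];
  wd_a1_cov : forall p, D p ->
    dfun (binv1 d) p - binv1 d p *: theta d p =
      binv11 d p *: omega d ix1 p + binv12 d p *: omega d ix2 p;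
  wd_a2_cov : forall p, D p ->
    dfun (binv2 d) p - binv2 d p *: theta d p =
      binv12 d p *: omega d ix1 p + binv22 d p *: omega d ix2 p
}.

Section CurvatureForms.
Variable d : web_data.
Let w12 : form2 F := wedge (omega d ix1) (omega d ix2).

Definition Theta123 : form2 F := fun p => curv d p * w12 p.

Definition Theta124 : form2 F := fun p =>
  (curv d p - binv12 d p / binv d p + (binv1 d p * binv2 d p) / binv d p ^+ 2) * w12 p.

Definition Theta134 : form2 F := fun p =>
  (curv d p + (binv2 d p * (binv1 d p - binv2 d p)) / (1 - binv d p) ^+ 2
     + (binv12 d p - binv22 d p) / (1 - binv d p)) * w12 p.

Definition Theta234 : form2 F := fun p =>
  (curv d p
     + ((2 * binv d p - 1) * binv1 d p * (binv1 d p - binv2 d p))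
         / (binv d p ^+ 2 * (1 - binv d p) ^+ 2)
     + (binv11 d p - binv12 d p) / (binv d p * (1 - binv d p))) * w12 p.

End CurvatureForms.

Definition nonconstant_invariant D (d : web_data) : Prop :=
  forall p, D p -> ~ (binv1 d p = 0 /\ binv2 d p = 0).

Definition equal_curvatures D (d : web_data) : Prop :=
  forall p, D p ->
    [/\ Theta123 d p = Theta124 d p, Theta123 d p = Theta134 d p
      & Theta123 d p = Theta234 d p].

Definition is_MW D X : Prop :=
  is_web D X /\
  exists d, [/\ is_web_data D X d, nonconstant_invariant D d
              & equal_curvatures D d].

End Webs.

(* Main.v *)
(* With k = (a a_2 - a_1) / (a (1 - a)) and c = (a_1 - a_2) / (1 - a), equality of
   the curvature forms gives dk = k theta and dc = c theta - c (k + c) omega_1.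
   Differentiating once more yields k K = c K = 0, and k and c vanish together
   only where a_1 = a_2 = 0; hence K = 0. The forms theta - k omega_1 and
   theta + k omega_2 are then closed, so that they are logarithmic differentials
   of functions lambda and mu, for which lambda omega_1 = du and mu omega_2 = dv
   are exact. In the coordinates (u, v) the leaves of X_1 and X_2 are coordinate
   lines, and those of X_3 and X_4 have slopes - mu / lambda and - a mu / lambda,
   which are constant along the leaves because
   d(mu / lambda) = (mu / lambda) k (omega_1 + omega_2) and
   d(a mu / lambda) = - (mu / lambda) c (a omega_1 + omega_2).
   The calculus needed for this is uniform in the field, real or complex:
   primitives are limits of Riemann sums along segments, controlled by a mean
   value inequality, and the exponential is the local inverse of a primitive of
   1 / (1 + x). *)
Require Import Defs.
From HB Require Import structures.
From mathcomp Require Import all_boot all_order all_algebra.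
From mathcomp Require Import all_classical all_reals all_analysis complex.
From mathcomp Require Import ring lra.

Set Implicit Arguments.
Unset Strict Implicit.
Unset Printing Implicit Defensive.

Import Order.TTheory GRing.Theory Num.Theory.
Import numFieldNormedType.Exports.

Local Open Scope classical_set_scope.
Local Open Scope ring_scope.

(** The function [k] is forced once [X_1] and [X_2] are to be coordinate lines and [X_3], [X_4]
    straight. If [lambda omega_1] and [mu omega_2] are closed, the logarithmic differentials of
    [lambda] and [mu] differ from [theta] only by multiples of [omega_1] and of [omega_2]. The slope
    of [X_3] is constant along its leaves exactly when these multiples are [- k] and [k] for one
    function [k]; for [X_4] the same demand reads [a_1 / a + k = a_2 + a k], which determines [k],
    and [- c / a] is then the factor of [a omega_1 + omega_2] in the logarithmic differential of
    [a mu / lambda]. The obstruction is the curvature: because [dk = k theta], the differentials of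
    [theta - k omega_1] and [theta + k omega_2] both reduce to that of [theta], so [K = 0] has to be
    known before any coordinate is built. The relation for [k] alone does not give it, as [k] may
    vanish while [a] is not constant; this is where [c] enters. *)

(* The norm of [F] takes values in the partially ordered [F]; [mdl] is the same
   norm with values in the real numbers, so that estimates can use [lra]. *)
Record modulus (R : realType) (F : numFieldType) := Modulus {
  emb : {rmorphism R -> F};
  mdl : F -> R;
  norm_mdl : forall x, `|x| = emb (mdl x);
  emb_le : {mono emb : x y / x <= y};
  mdl_complete : forall u : nat -> F,
    (forall e, 0 < e -> exists k, forall m n,
       (k <= m)%N -> (k <= n)%N -> mdl (u m - u n) < e) ->
    exists l, forall e, 0 < e -> exists k, forall n,
       (k <= n)%N -> mdl (u n - l) < e
}.

(** * Real-valued norm and box neighbourhoods *)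

Section Modulus.
Variables (R : realType) (F : numFieldType) (M : modulus R F).
Local Notation N := (mdl M).
Local Notation em := (emb M).
Implicit Types (x y : F) (p q v : pt F) (f : pt F -> F).

Let nE x : `|x| = em (N x) := norm_mdl M x.

Lemma emb_lt : {mono em : r s / r < s}.
Proof. exact: leW_mono (emb_le M). Qed.

Lemma emb_inj : injective em.
Proof. exact: fmorph_inj. Qed.

Lemma mdl_ge0 x : 0 <= N x.
Proof. by rewrite -(emb_le M) -nE rmorph0. Qed.

Lemma mdl0 : N 0 = 0.
Proof. by apply: emb_inj; rewrite -nE normr0 rmorph0. Qed.

Lemma mdl0_eq0 x : N x = 0 -> x = 0.
Proof. by move=> h; apply: normr0_eq0; rewrite nE h rmorph0. Qed.

Lemma mdl_gt0 x : (0 < N x) = (x != 0).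
Proof.
rewrite lt_def mdl_ge0 andbT; congr (~~ _).
by apply/eqP/eqP => [/mdl0_eq0 //|->]; rewrite mdl0.
Qed.

Lemma mdlD x y : N (x + y) <= N x + N y.
Proof. by rewrite -(emb_le M) rmorphD /= -!nE ler_normD. Qed.

Lemma mdlN x : N (- x) = N x.
Proof. by apply: emb_inj; rewrite -!nE normrN. Qed.

Lemma mdlC x y : N (x - y) = N (y - x).
Proof. by rewrite -mdlN opprB. Qed.

Lemma mdlB x y : N (x - y) <= N x + N y.
Proof. by rewrite -(mdlN y) mdlD. Qed.

Lemma mdlM x y : N (x * y) = N x * N y.
Proof. by apply: emb_inj; rewrite rmorphM /= -!nE normrM. Qed.

Lemma mdl1 : N 1 = 1.
Proof. by apply: emb_inj; rewrite rmorph1 -nE normr1. Qed.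

Lemma mdl_emb r : N (em r) = `|r|.
Proof.
apply: emb_inj; rewrite -nE.
have e0 s : 0 <= s -> 0 <= em s by rewrite -[s in X in X -> _]subr0 subr0 -(rmorph0 em) emb_le.
case: (ger0P r) => hr; first by rewrite ger0_norm // e0.
by rewrite ler0_norm ?rmorphN // -(rmorph0 em) emb_le ltW.
Qed.

Lemma mdlV x : N x^-1 = (N x)^-1.
Proof. by apply: emb_inj; rewrite fmorphV -!nE normfV. Qed.

(** A positive element of [F] is its own norm and so comes from [R]; through this, radii and
    tolerances in [F] are exchanged for real ones. *)
Lemma gt0_emb (e : F) : 0 < e -> e = em (N e) /\ 0 < N e.
Proof. by move=> e0; rewrite -nE gtr0_norm // mdl_gt0 gt_eqF. Qed.

Lemma emb_gt0 (r : R) : 0 < r -> 0 < em r.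
Proof. by move=> r0; rewrite -(rmorph0 em) emb_lt. Qed.

Lemma mdl_sum n (g : 'I_n -> F) : N (\sum_(i < n) g i) <= \sum_(i < n) N (g i).
Proof.
elim/big_ind2 : _ => [|x a y b hx hy|//]; first by rewrite mdl0.
by apply: le_trans (mdlD _ _) _; exact: lerD.
Qed.

Definition nm (v : pt F) : R := Num.max (N v.1) (N v.2).
Definition box p (r : R) : set (pt F) := [set q | nm (q - p) < r].

Lemma nm_lt v r : (nm v < r) = (N v.1 < r) && (N v.2 < r).
Proof. by rewrite /nm gt_max. Qed.

Lemma nm_le v r : (nm v <= r) = (N v.1 <= r) && (N v.2 <= r).
Proof. by rewrite /nm ge_max. Qed.

Lemma nm_fst v : N v.1 <= nm v.
Proof. by rewrite /nm le_max lexx. Qed.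

Lemma nm_snd v : N v.2 <= nm v.
Proof. by rewrite /nm le_max lexx orbT. Qed.

Lemma nm_ge0 v : 0 <= nm v.
Proof. exact: le_trans (mdl_ge0 _) (nm_fst _). Qed.

Lemma nm0 : nm 0 = 0.
Proof. by rewrite /nm mdl0 maxxx. Qed.

Lemma nm0_eq0 v : nm v = 0 -> v = 0.
Proof.
move=> h; have := nm_fst v; have := nm_snd v; rewrite h.
move=> h2 h1; case: v h h1 h2 => a b _ /= h1 h2.
by congr pair; apply: mdl0_eq0; apply/eqP; rewrite eq_le mdl_ge0 ?h1 ?h2.
Qed.

Lemma nmD v w : nm (v + w) <= nm v + nm w.
Proof.
rewrite nm_le; apply/andP; split; (apply: le_trans (mdlD _ _) _); apply: lerD;
  by rewrite ?nm_fst ?nm_snd.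
Qed.

Lemma nmN v : nm (- v) = nm v.
Proof. by rewrite /nm !mdlN. Qed.

Lemma nmC v w : nm (v - w) = nm (w - v).
Proof. by rewrite -nmN opprB. Qed.

Lemma nmZ a v : nm (a *: v) = N a * nm v.
Proof. by rewrite /nm /= !mdlM maxr_pMr // mdl_ge0. Qed.

Lemma nmBD u v w : nm (u - w) <= nm (u - v) + nm (v - w).
Proof. by have := nmD (u - v) (v - w); rewrite addrA subrK. Qed.

Lemma box_center p r : 0 < r -> box p r p.
Proof. by move=> r0; rewrite /box /= subrr nm0. Qed.

Lemma sub_box p r s : r <= s -> box p r `<=` box p s.
Proof. by move=> rs q /lt_le_trans; apply. Qed.

Lemma nbhs_boxP p (A : set (pt F)) :
  nbhs p A <-> exists2 r : R, 0 < r & box p r `<=` A.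
Proof.
split.
  move/nbhs_ballP => [e /= e0 h]; have [ee Ne0] := gt0_emb e0.
  exists (N e) => // q; rewrite /box /= nm_lt => /andP[h1 h2]; apply: h.
  by split; rewrite -ball_normE /ball_ /= distrC nE ee emb_lt.
move=> [r r0 h]; apply/nbhs_ballP; exists (em r); first exact: emb_gt0.
move=> q [/=]; rewrite -!ball_normE /ball_ /= !(distrC p.1) !(distrC p.2) !nE !emb_lt.
by move=> h1 h2; apply: h; rewrite /box /= nm_lt h1.
Qed.

Lemma nbhs_mdlP x (A : set F) :
  nbhs x A <-> exists2 r : R, 0 < r & forall y, N (y - x) < r -> A y.
Proof.
split.
  move/nbhs_ballP => [e /= e0 h]; have [ee Ne0] := gt0_emb e0.
  exists (N e) => // q hq; apply: h; rewrite -ball_normE /ball_ /= distrC nE.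
  by rewrite ee emb_lt.
move=> [r r0 h]; apply/nbhs_ballP; exists (em r); first exact: emb_gt0.
by move=> q; rewrite -ball_normE /ball_ /= distrC nE emb_lt; exact: h.
Qed.

Lemma open_box p r : open (box p r).
Proof.
rewrite openE => q hq; apply/nbhs_boxP.
exists (r - nm (q - p)); first by rewrite subr_gt0.
move=> s; rewrite /box /= ltrBrDr => h.
exact: le_lt_trans (nmBD s q p) h.
Qed.

Lemma open_boxP (D : set (pt F)) p : open D -> D p ->
  exists2 r : R, 0 < r & box p r `<=` D.
Proof. by rewrite openE => oD Dp; apply/nbhs_boxP; exact: oD. Qed.

Lemma continuous_mdlP f p : {for p, continuous f} <->
  forall e, 0 < e -> exists2 d, 0 < d & forall q, box p d q -> N (f q - f p) < e.
Proof.
split.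
  move=> cf e e0; have /nbhs_boxP[r r0 h] : nbhs p (f @^-1` [set y | N (y - f p) < e]).
    by apply: cf; apply/nbhs_mdlP; exists e.
  by exists r.
move=> h A /nbhs_mdlP[r r0 hA]; have [d d0 hd] := h _ r0.
by apply/nbhs_boxP; exists d => // q /hd; exact: hA.
Qed.

End Modulus.

(** * Calculus of two variables over a field with real-valued norm *)

Section Coordinates.
Variable F : numFieldType.
Implicit Types (p q : pt F) (a x y : F).

Lemma ptD1 p q : (p + q).1 = p.1 + q.1 :> F. Proof. by []. Qed.
Lemma ptD2 p q : (p + q).2 = p.2 + q.2 :> F. Proof. by []. Qed.
Lemma ptB1 p q : (p - q).1 = p.1 - q.1 :> F. Proof. by []. Qed.
Lemma ptB2 p q : (p - q).2 = p.2 - q.2 :> F. Proof. by []. Qed.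
Lemma ptZ1 a p : (a *: p).1 = a * p.1 :> F. Proof. by []. Qed.
Lemma ptZ2 a p : (a *: p).2 = a * p.2 :> F. Proof. by []. Qed.
Lemma pt_eq p q : p.1 = q.1 -> p.2 = q.2 -> p = q.
Proof. by case: p q => [a b] [c d] /= -> ->. Qed.
Definition ptE := (ptD1, ptD2, ptB1, ptB2, ptZ1, ptZ2).

End Coordinates.

Section LinearForm.
Variables (F : numFieldType) (A B : F).

Definition lin2 (v : pt F) : F := A * v.1 + B * v.2.

Lemma lin2_is_linear : linear lin2.
Proof.
by move=> a u v; rewrite /lin2 !ptE -[RHS]/(a * (A * u.1 + B * u.2) + (A * v.1 + B * v.2)); ring.
Qed.

Lemma lin2D u v : lin2 (u + v) = lin2 u + lin2 v.
Proof. by rewrite /lin2 !ptE; ring. Qed.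

Lemma lin2B u v : lin2 (u - v) = lin2 u - lin2 v.
Proof. by rewrite /lin2 !ptE; ring. Qed.

Lemma lin2Z a v : lin2 (a *: v) = a * lin2 v.
Proof. by rewrite /lin2 !ptE; ring. Qed.

HB.instance Definition _ := GRing.isLinear.Build F (F * F)%type F _ lin2 lin2_is_linear.

End LinearForm.

Section Derivatives.
Variables (R : realType) (F : numFieldType) (M : modulus R F).
Local Notation N := (mdl M).
Local Notation em := (emb M).
Local Notation nm := (nm M).
Local Notation box := (box M).
Implicit Types (x y : F) (p q v : pt F) (f g : pt F -> F).

(** One predicate carries differentiability together with the gradient: the rules below produce
    explicit coefficients, and [hasd_ext] leaves their comparison to [ring] or [field]. *)
Definition hasd f p (A B : F) : Prop := is_diff p f (lin2 A B).

Lemma norm_nm v : `|v| = em (nm v).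
Proof.
rewrite prod_normE !(norm_mdl M) /nm.
have h (x y : R) : Num.max (em x) (em y) = em (Num.max x y) by rewrite /Order.max emb_lt; case: (x < y).
exact: h.
Qed.

Lemma lin2_bound A B v : N (lin2 A B v) <= (N A + N B) * nm v.
Proof.
apply: le_trans (mdlD _ _ _) _; rewrite !mdlM mulrDl.
by apply: lerD; apply: ler_wpM2l; rewrite ?mdl_ge0 ?nm_fst ?nm_snd.
Qed.

Lemma continuous_lin2 (A B : F) : continuous (lin2 A B : F * F -> F).
Proof.
move=> p; apply/(continuous_mdlP M) => e e0.
have h0 : 0 < N A + N B + 1 by rewrite ltr_wpDl // addr_ge0 // mdl_ge0.
exists (e / (N A + N B + 1)); first by rewrite divr_gt0.
move=> q; rewrite /box /= ltr_pdivlMr // => h.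
rewrite -raddfB; apply: le_lt_trans (lin2_bound _ _ _) _; apply: le_lt_trans h.
by rewrite mulrC ler_wpM2l ?nm_ge0 // lerDl.
Qed.

Lemma hasdP f p A B : hasd f p A B <->
  forall e, 0 < e -> exists2 d, 0 < d & forall q, box p d q ->
    N (f q - f p - lin2 A B (q - p)) <= e * nm (q - p).
Proof.
split.
  move=> [/diff_locallyP[_ h] hd] e e0; move/eqaddoP: h.
  move=> /(_ _ (emb_gt0 M e0)) /(nbhs_boxP M)[d d0 h].
  exists d => // q hq; have := h (q - p).
  rewrite /box /= subr0 => /(_ hq).
  rewrite hd (norm_mdl M) norm_nm -rmorphM emb_le /=.
  by rewrite !fctE /= subrK opprD addrA.
move=> h.
pose f' : (F * F)%type -> F := f.
have hl : f' \o shift p = cst (f' p) + (lin2 A B : F * F -> F) +o_ (0 : F * F) id.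
  apply/eqaddoP => e /(gt0_emb M)[ee e0]; have [d d0 hd] := h _ e0.
  apply/(nbhs_boxP M); exists d => // v; rewrite /box /= subr0 => hv.
  rewrite (norm_mdl M) norm_nm ee -rmorphM emb_le !fctE /= opprD addrA.
  have := hd (v + p); rewrite /box /= addrK; exact.
have hu := diff_unique (@continuous_lin2 A B) hl.
by apply: DiffDef => //; apply/diff_locallyP; rewrite hu; split=> //; exact: continuous_lin2.
Qed.

Lemma hasd_diff f p A B : hasd f p A B ->
  [/\ differentiable f p, pd1 f p = A & pd2 f p = B].
Proof.
move=> [h hd]; split=> //; rewrite /pd1 /pd2 deriveE // hd /lin2 /=; ring.
Qed.

Lemma diff_hasd f p : differentiable f p -> hasd f p (pd1 f p) (pd2 f p).
Proof.
move=> h; apply: DiffDef => //; apply/funext => v.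
rewrite /pd1 /pd2 !deriveE // /lin2.
have -> : v = v.1 *: ((1, 0) : pt F) + v.2 *: ((0, 1) : pt F).
  by case: v => a b; congr pair => /=; rewrite /GRing.scale /=; ring.
rewrite linearD !linearZ /=; congr (_ + _); rewrite /GRing.scale /=; ring.
Qed.

Lemma hasd_cst a p : hasd (fun=> a) p 0 0.
Proof.
by apply: is_diff_eq; apply/funext => v; rewrite /lin2 !mul0r addr0.
Qed.

Lemma hasd_lin2 A B p : hasd (lin2 A B) p A B.
Proof.
apply/hasdP => e e0; exists 1 => // q _.
by rewrite raddfB subrr mdl0 mulr_ge0 ?nm_ge0 // ltW.
Qed.

Lemma hasd_near f g p A B (D : set (pt F)) : open D -> D p ->
  (forall q, D q -> f q = g q) -> hasd f p A B -> hasd g p A B.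
Proof.
move=> oD Dp fg /hasdP h; apply/hasdP => e e0.
have [d d0 hd] := h _ e0; have [r r0 hr] := open_boxP M oD Dp.
exists (Num.min d r); first by rewrite lt_min d0.
move=> q; rewrite /box /= lt_min => /andP[h1 h2].
by rewrite -!fg //; [exact: hd | exact: hr].
Qed.

Lemma hasd_ext f g p A B A' B' : f = g -> A = A' -> B = B' ->
  hasd f p A B -> hasd g p A' B'.
Proof. by move=> -> -> ->. Qed.

Lemma hasd_fst p : hasd fst p 1 0.
Proof.
apply: hasd_ext (hasd_lin2 1 0 p) => //.
by apply/funext => v; rewrite /lin2 mul1r mul0r addr0.
Qed.

Lemma hasd_snd p : hasd snd p 0 1.
Proof.
apply: hasd_ext (hasd_lin2 0 1 p) => //.
by apply/funext => v; rewrite /lin2 mul1r mul0r add0r.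
Qed.

Section Rules.
Variables (f g : pt F -> F) (p : pt F) (A B A' B' : F).
Hypotheses (hf : hasd f p A B) (hg : hasd g p A' B').

Lemma hasdD : hasd (fun q => f q + g q) p (A + A') (B + B').
Proof.
have := hf; have := hg; rewrite /hasd => h1 h2; apply: is_diff_eq.
by apply/funext => v /=; rewrite /lin2 ?fctE; ring.
Qed.

Lemma hasdB : hasd (fun q => f q - g q) p (A - A') (B - B').
Proof.
have := hf; have := hg; rewrite /hasd => h1 h2; apply: is_diff_eq.
by apply/funext => v /=; rewrite /lin2 ?fctE; ring.
Qed.

Lemma hasdM : hasd (fun q => f q * g q) p (A * g p + f p * A') (B * g p + f p * B').
Proof.
have := hf; have := hg; rewrite /hasd => h1 h2; apply: is_diff_eq.
by apply/funext => v /=; rewrite /lin2 ?fctE /GRing.scale /=; ring.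
Qed.

Lemma hasdV : f p != 0 -> hasd (fun q => (f q)^-1) p (- A / f p ^+ 2) (- B / f p ^+ 2).
Proof.
move=> f0; have := hf; rewrite /hasd => -[h1 h2].
have h3 := differentiableV h1 f0.
apply: DiffDef => //; rewrite (diffV h1 f0) h2.
apply/funext => v /=; rewrite /lin2 ?fctE /GRing.scale /= /GRing.scale /=.
by field.
Qed.

End Rules.

Lemma hasdF f g p A B A' B' : hasd f p A B -> hasd g p A' B' -> g p != 0 ->
  hasd (fun q => f q / g q) p ((A * g p - f p * A') / g p ^+ 2)
                             ((B * g p - f p * B') / g p ^+ 2).
Proof.
move=> hf hg g0; have hv := hasdM hf (hasdV hg g0).
by apply: hasd_ext hv => //; field.
Qed.

Lemma hasd_comp f g1 g2 p A B A1 B1 A2 B2 :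
  hasd f (g1 p, g2 p) A B -> hasd g1 p A1 B1 -> hasd g2 p A2 B2 ->
  hasd (fun q => f (g1 q, g2 q)) p (A * A1 + B * A2) (A * B1 + B * B2).
Proof.
move=> hf h1 h2; have := @is_diff_pair; move: hf h1 h2; rewrite /hasd => hf h1 h2 _.
have h := is_diff_pair h1 h2.
have hc := @is_diff_comp _ _ _ _ _ _ _ _ p h hf.
apply: is_diff_eq hc _; apply/funext => v /=; rewrite /lin2 /=; ring.
Qed.

Lemma hasd_sum n (h : 'I_n -> pt F -> F) p (A B : 'I_n -> F) :
  (forall i, hasd (h i) p (A i) (B i)) ->
  hasd (fun q => \sum_(i < n) h i q) p (\sum_(i < n) A i) (\sum_(i < n) B i).
Proof.
elim: n h A B => [|n IH] h A B H.
  by apply: hasd_ext (hasd_cst 0 p); rewrite ?big_ord0 //; apply/funext => q; rewrite big_ord0.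
have := hasdD (IH (fun i => h (widen_ord (leqnSn n) i)) _ _ (fun i => H _)) (H ord_max).
by apply: hasd_ext; rewrite ?big_ord_recr //; apply/funext => q; rewrite big_ord_recr.
Qed.

Lemma hasd_continuous f p A B : hasd f p A B -> {for p, continuous f}.
Proof. by case=> /differentiable_continuous. Qed.

End Derivatives.

(** * Closure properties of smooth functions *)

Section Smoothness.
Variables (R : realType) (F : numFieldType) (M : modulus R F).
Local Notation N := (mdl M).
Implicit Types (D E : set (pt F)) (p q : pt F) (f g : pt F -> F).

Lemma Ck_hasd n D f p : Ck n.+1 D f -> D p -> hasd f p (pd1 f p) (pd2 f p).
Proof. by move=> [h _ _] Dp; apply: diff_hasd; exact: h. Qed.

Lemma Ck_sub n D E f : E `<=` D -> Ck n D f -> Ck n E f.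
Proof.
move=> ED; elim: n f => [|n IH] f; first by move=> h p /ED; exact: h.
by move=> [h1 h2 h3]; split; [move=> p /ED; exact: h1 | exact: IH | exact: IH].
Qed.

Lemma CkW n D f : Ck n.+1 D f -> Ck n D f.
Proof.
elim: n f => [|n IH] f [h1 h2 h3].
  move=> p Dp; exact (differentiable_continuous (h1 p Dp)).
split; first exact h1.
  exact (IH _ h2).
exact (IH _ h3).
Qed.

Lemma continuous_near f g p D : open D -> D p -> (forall q, D q -> f q = g q) ->
  {for p, continuous f} -> {for p, continuous g}.
Proof.
move=> oD Dp fg /(continuous_mdlP M) h; apply/(continuous_mdlP M) => e e0.
have [d d0 hd] := h _ e0; have [r r0 hr] := open_boxP M oD Dp.
exists (Num.min d r); first by rewrite lt_min d0.
move=> q; rewrite /box /= lt_min => /andP[h1 h2].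
by rewrite -!fg //; [exact: hd | exact: hr].
Qed.

(** [pd1 f] and [P] agree on [D] only, so neither can be rewritten into the other. Since [D] is
    open, [pd1 f] inherits there the gradient of [P], and the induction hypothesis applies to it
    with the partial derivatives of [P]. *)
Lemma Ck_step n D f P Q : open D -> (forall p, D p -> hasd f p (P p) (Q p)) ->
  Ck n D P -> Ck n D Q -> Ck n.+1 D f.
Proof.
move=> oD; elim: n f P Q => [|n IH] f P Q hf hP hQ.
  split=> [p /hf /hasd_diff[]//|p Dp|p Dp].
    apply: (continuous_near oD Dp) (hP p Dp) => q /hf /hasd_diff[]//.
  by apply: (continuous_near oD Dp) (hQ p Dp) => q /hf /hasd_diff[]//.
split=> [p /hf /hasd_diff[]//||].
- case: hP => hP1 hP2 hP3; apply: (IH _ (pd1 P) (pd2 P)) => // p Dp.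
  apply: (hasd_near M oD Dp) (diff_hasd (hP1 p Dp)) => q /hf /hasd_diff[]//.
- case: hQ => hQ1 hQ2 hQ3; apply: (IH _ (pd1 Q) (pd2 Q)) => // p Dp.
  apply: (hasd_near M oD Dp) (diff_hasd (hQ1 p Dp)) => q /hf /hasd_diff[]//.
Qed.

Lemma Ck_ext n D f g : open D -> (forall p, D p -> f p = g p) -> Ck n D f -> Ck n D g.
Proof.
move=> oD fg; case: n => [h p Dp|n [h1 h2 h3]].
  by apply: (continuous_near oD Dp) (h p Dp).
apply: (Ck_step oD) h2 h3 => p Dp.
by apply: (hasd_near M oD Dp) (diff_hasd (h1 p Dp)).
Qed.

Lemma Ck_cst n D (a : F) : open D -> Ck n D (fun=> a).
Proof.
move=> oD; elim: n a => [|n IH] a; first by move=> p _; exact: cvg_cst.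
by apply: (Ck_step oD) (IH 0) (IH 0) => p _; exact: hasd_cst.
Qed.

Lemma Ck_fst n D : open D -> Ck n D fst.
Proof.
move=> oD; apply: CkW; apply: (Ck_step oD _ (Ck_cst n 1 oD) (Ck_cst n 0 oD)) => p _.
exact: (hasd_fst M).
Qed.

Lemma Ck_snd n D : open D -> Ck n D snd.
Proof.
move=> oD; apply: CkW; apply: (Ck_step oD _ (Ck_cst n 0 oD) (Ck_cst n 1 oD)) => p _.
exact: (hasd_snd M).
Qed.

Lemma CkD n D f g : open D -> Ck n D f -> Ck n D g -> Ck n D (fun q => f q + g q).
Proof.
move=> oD; elim: n f g => [|n IH] f g; first by move=> h1 h2 p Dp; apply: cvgD; [exact: h1 | exact: h2].
move=> [f1 f2 f3] [g1 g2 g3]; apply: (Ck_step oD) (IH _ _ f2 g2) (IH _ _ f3 g3) => p Dp.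
by apply: hasdD; apply: diff_hasd; [exact: f1 | exact: g1].
Qed.

Lemma CkM n D f g : open D -> Ck n D f -> Ck n D g -> Ck n D (fun q => f q * g q).
Proof.
move=> oD; elim: n f g => [|n IH] f g; first by move=> h1 h2 p Dp; apply: cvgM; [exact: h1 | exact: h2].
move=> hf hg; have hf' := CkW hf; have hg' := CkW hg.
case: hf hg => [f1 f2 f3] [g1 g2 g3].
apply: (Ck_step oD) (CkD oD (IH _ _ f2 hg') (IH _ _ hf' g2))
                    (CkD oD (IH _ _ f3 hg') (IH _ _ hf' g3)) => p Dp.
by apply: hasdM; apply: diff_hasd; [exact: f1 | exact: g1].
Qed.

Lemma CkN n D f : open D -> Ck n D f -> Ck n D (fun q => - f q).
Proof.
move=> oD hf; apply: (Ck_ext oD _ (CkM oD (Ck_cst n (-1) oD) hf)) => p _.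
by rewrite mulN1r.
Qed.

Lemma CkB n D f g : open D -> Ck n D f -> Ck n D g -> Ck n D (fun q => f q - g q).
Proof. by move=> oD hf hg; exact: CkD oD hf (CkN oD hg). Qed.

Lemma CkV n D f : open D -> (forall p, D p -> f p != 0) -> Ck n D f ->
  Ck n D (fun q => (f q)^-1).
Proof.
move=> oD f0; elim: n f f0 => [|n IH] f f0.
  by move=> h p Dp; apply: cvgV; [exact: f0 | exact: h].
move=> hf; have hv := IH _ f0 (CkW hf); case: hf => [f1 f2 f3].
have hv2 := CkM oD hv hv.
apply: (Ck_step oD) (CkN oD (CkM oD f2 hv2)) (CkN oD (CkM oD f3 hv2)) => p Dp.
have := hasdV (diff_hasd (f1 p Dp)) (f0 p Dp).
by apply: hasd_ext; rewrite // expr2 invfM mulNr.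
Qed.

Lemma Ck_comp n D E f g1 g2 : open D -> open E -> (forall p, D p -> E (g1 p, g2 p)) ->
  Ck n E f -> Ck n D g1 -> Ck n D g2 -> Ck n D (fun q => f (g1 q, g2 q)).
Proof.
move=> oD oE gE; elim: n f => [|n IH] f hf h1 h2.
  move=> p Dp; apply: (@continuous_comp _ _ _ (fun q => (g1 q, g2 q)) f).
    exact: (cvg_pair (h1 p Dp) (h2 p Dp)).
  exact: (hf _ (gE p Dp)).
have h1' := CkW h1; have h2' := CkW h2.
case: hf h1 h2 => [f1 f2 f3] [h11 h12 h13] [h21 h22 h23].
apply: (Ck_step oD)
  (CkD oD (CkM oD (IH _ f2 h1' h2') h12) (CkM oD (IH _ f3 h1' h2') h22))
  (CkD oD (CkM oD (IH _ f2 h1' h2') h13) (CkM oD (IH _ f3 h1' h2') h23)) => p Dp.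
exact: (hasd_comp (diff_hasd (f1 _ (gE p Dp))) (diff_hasd (h11 p Dp)) (diff_hasd (h21 p Dp))).
Qed.

Lemma smooth_hasd D f p : smooth D f -> D p -> hasd f p (pd1 f p) (pd2 f p).
Proof. by move=> /(_ 1%N); exact: Ck_hasd. Qed.

Lemma smooth_pd1 D f : smooth D f -> smooth D (pd1 f).
Proof. by move=> h n; case: (h n.+1). Qed.

Lemma smooth_pd2 D f : smooth D f -> smooth D (pd2 f).
Proof. by move=> h n; case: (h n.+1). Qed.

Lemma smooth_sub D E f : E `<=` D -> smooth D f -> smooth E f.
Proof. by move=> ED h n; apply: Ck_sub ED (h n). Qed.

Lemma smooth_step D f P Q : open D -> (forall p, D p -> hasd f p (P p) (Q p)) ->
  smooth D P -> smooth D Q -> smooth D f.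
Proof. by move=> oD hf hP hQ n; apply: CkW; exact: (Ck_step oD hf (hP n) (hQ n)). Qed.

Lemma smooth_ext D f g : open D -> (forall p, D p -> f p = g p) -> smooth D f -> smooth D g.
Proof. by move=> oD fg h n; exact: (Ck_ext oD fg (h n)). Qed.

Lemma smooth_cst D (a : F) : open D -> smooth D (fun=> a).
Proof. by move=> oD n; exact: Ck_cst. Qed.

Lemma smooth_fst D : open D -> smooth D fst.
Proof. by move=> oD n; exact: Ck_fst. Qed.

Lemma smooth_snd D : open D -> smooth D snd.
Proof. by move=> oD n; exact: Ck_snd. Qed.

Lemma smoothD D f g : open D -> smooth D f -> smooth D g -> smooth D (fun q => f q + g q).
Proof. by move=> oD hf hg n; exact: CkD. Qed.

Lemma smoothM D f g : open D -> smooth D f -> smooth D g -> smooth D (fun q => f q * g q).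
Proof. by move=> oD hf hg n; exact: CkM. Qed.

Lemma smoothB D f g : open D -> smooth D f -> smooth D g -> smooth D (fun q => f q - g q).
Proof. by move=> oD hf hg n; exact: CkB. Qed.

Lemma smoothF D f g : open D -> (forall p, D p -> g p != 0) ->
  smooth D f -> smooth D g -> smooth D (fun q => f q / g q).
Proof. by move=> oD g0 hf hg n; apply: CkM => //; exact: CkV. Qed.

Lemma smooth_comp D E f g1 g2 : open D -> open E -> (forall p, D p -> E (g1 p, g2 p)) ->
  smooth E f -> smooth D g1 -> smooth D g2 -> smooth D (fun q => f (g1 q, g2 q)).
Proof. by move=> oD oE gE hf h1 h2 n; exact: (Ck_comp oD oE gE (hf n) (h1 n) (h2 n)). Qed.

Lemma smooth_continuous D f p : smooth D f -> D p -> {for p, continuous f}.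
Proof. by move=> /(_ 0%N); apply. Qed.

End Smoothness.

(** * Mean value inequality and symmetry of second derivatives *)

Section MeanValue.
Variables (R : realType) (F : numFieldType) (M : modulus R F).
Local Notation N := (mdl M).
Local Notation em := (emb M).
Local Notation nm := (nm M).
Local Notation box := (box M).
Implicit Types (p q : pt F) (f : pt F -> F).

(** Continuous induction. Let [T] be the supremum of the times up to which the linear bound holds.
    The local estimate at [T] carries the bound from a slightly earlier time to [T], and then from
    [T] to later times, so that [T] can only be 1. *)
Lemma curve_growth (G : R -> F) (L : R) :
  (forall t, 0 <= t <= 1 -> exists2 d, 0 < d &
     forall s, 0 <= s <= 1 -> `|s - t| < d -> N (G s - G t) <= L * `|s - t|) ->
  N (G 1 - G 0) <= L.
Proof.
move=> h; pose P s := N (G s - G 0) <= L * s.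
pose S := [set t : R | 0 <= t <= 1 /\ forall s, 0 <= s <= t -> P s].
have P0 : P 0 by rewrite /P subrr mdl0 mulr0.
have S0 : S 0.
  split; first by lra.
  by move=> s hs; have -> : s = 0 by lra.
have hS : has_sup S by split; [exists 0 | exists 1 => t [? _]; lra].
pose T := sup S.
have T0 : 0 <= T by apply: ub_le_sup => //; exact: hS.2.
have T1 : T <= 1 by apply: ge_sup => [|t [? _]]; [exists 0 | lra].
have [d d0 hd] : exists2 d, 0 < d &
     forall s, 0 <= s <= 1 -> `|s - T| < d -> N (G s - G T) <= L * `|s - T|.
  by apply: h; lra.
have PltT s : 0 <= s < T -> P s.
  move=> hs; have e0 : 0 < T - s by lra.
  have [s1 [_ Ss1] hs1] := sup_adherent e0 hS.
  by apply: Ss1; rewrite -/T in hs1; lra.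
have PT : P T.
  have [s0 [hs01 Ss0] hs0] := sup_adherent d0 hS; rewrite -/T in hs0.
  have s0T : s0 <= T by apply: ub_le_sup => //; exact: hS.2.
  have h0 : P s0 by apply: Ss0; lra.
  have := hd s0; rewrite ler0_norm ?subr_le0 // => h1.
  have {}h1 : N (G s0 - G T) <= L * - (s0 - T) by apply: h1; lra.
  have h2 := mdlD M (G T - G s0) (G s0 - G 0).
  rewrite addrA subrK (mdlC M (G T)) in h2.
  by move: h0; rewrite /P => h0; lra.
have PgtT s : T <= s < T + d -> s <= 1 -> P s.
  move=> hs s1; have := hd s; rewrite ger0_norm ?subr_ge0; last by case/andP: hs.
  move=> h1; have {}h1 : N (G s - G T) <= L * (s - T) by apply: h1; lra.
  have h2 := mdlD M (G s - G T) (G T - G 0).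
  by rewrite addrA subrK in h2; move: PT; rewrite /P => PT; lra.
have eT : T = 1.
  apply/eqP; rewrite eq_le T1 /=; case: (leP 1 T) => // T1'.
  have : T < Num.min 1 (T + d / 2) by rewrite lt_min; lra.
  rewrite ltNge => /negP[]; apply: ub_le_sup; first exact: hS.2.
  have m1 : Num.min 1 (T + d / 2) <= 1 by rewrite ge_min lexx.
  have m2 : Num.min 1 (T + d / 2) <= T + d / 2 by rewrite ge_min lexx orbT.
  have m0 : 0 <= Num.min 1 (T + d / 2) by rewrite le_min; lra.
  split; first by lra.
  move=> s hs; case: (ltP s T) => sT; first by apply: PltT; lra.
  apply: PgtT; lra.
by move: PT; rewrite /P eT mulr1.
Qed.

Lemma curve_mean_value (G G' : R -> F) (K : R) :
  (forall t, 0 <= t <= 1 -> forall e, 0 < e -> exists2 d, 0 < d &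
     forall s, `|s - t| < d -> N (G s - G t - em (s - t) * G' t) <= e * `|s - t|) ->
  (forall t, 0 <= t <= 1 -> N (G' t) <= K) ->
  N (G 1 - G 0) <= K.
Proof.
move=> hG hK; apply/ler_addgt0Pr => e e0; apply: curve_growth => t ht.
have [d d0 hd] := hG t ht e e0; exists d => // s _ /hd h.
have := mdlD M (G s - G t - em (s - t) * G' t) (em (s - t) * G' t).
rewrite subrK => h2; apply: le_trans h2 _; rewrite mdlM mdl_emb.
have := ler_wpM2l (normr_ge0 (s - t)) (hK t ht); lra.
Qed.

(** The function [f - lin2 A B] is followed along the segment. The factor 2 comes from [lin2_bound],
    which adds the deviations of the two partial derivatives. *)
Lemma mean_value f (p q : pt F) (A B : F) (P Q : pt F -> F) (K : R) :
  (forall t : R, 0 <= t <= 1 -> let r := p + em t *: (q - p) in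
     [/\ hasd f r (P r) (Q r), N (P r - A) <= K & N (Q r - B) <= K]) ->
  N (f q - f p - lin2 A B (q - p)) <= 2 * K * nm (q - p).
Proof.
move=> h; pose z (t : R) := p + em t *: (q - p).
pose G t := f (z t) - lin2 A B (z t).
pose G' t := lin2 (P (z t) - A) (Q (z t) - B) (q - p).
have zB s t : z s - z t = em (s - t) *: (q - p).
  by rewrite /z opprD addrACA subrr add0r rmorphB scalerBl.
have <- : G 1 - G 0 = f q - f p - lin2 A B (q - p).
  have z1 : z 1 = q by rewrite /z rmorph1 scale1r addrC subrK.
  have z0 : z 0 = p by rewrite /z rmorph0 scale0r addr0.
  by rewrite /G z1 z0 lin2B; ring.
have n0 := nm_ge0 M (q - p).
apply: (curve_mean_value (G' := G')) => t ht; last first.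
  have [_ h1 h2] := h t ht; apply: le_trans (lin2_bound M _ _ _) _.
  by apply: ler_wpM2r => //; rewrite /z; lra.
have [hd _ _] := h t ht; move=> e e0.
have n1 : 0 < nm (q - p) + 1 by lra.
have [d d0 hh] := (hasdP M _ _ _ _).1 hd (e / (nm (q - p) + 1)) (divr_gt0 e0 n1).
exists (d / (nm (q - p) + 1)); first exact: divr_gt0.
move=> s; rewrite ltr_pdivlMr // => hs.
have nz : nm (z s - z t) = `|s - t| * nm (q - p) by rewrite zB nmZ mdl_emb.
have -> : G s - G t - em (s - t) * G' t
        = f (z s) - f (z t) - lin2 (P (z t)) (Q (z t)) (z s - z t).
  rewrite /G /G' zB lin2Z.
  have -> : lin2 A B (z s) = lin2 A B (z t) + em (s - t) * lin2 A B (q - p).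
    by rewrite -lin2Z -zB -lin2D addrC subrK.
  by rewrite /lin2; ring.
have s0 := normr_ge0 (s - t).
apply: le_trans (hh _ _) _.
  rewrite /box /= -/(z t) nz; apply: le_lt_trans hs; rewrite ler_wpM2l //; lra.
rewrite -/(z t) nz mulrCA mulrC ler_wpM2r // mulrAC ler_pdivrMr //.
by apply: ler_wpM2l; [exact: ltW | lra].
Qed.

Lemma box_segment c r p q (t : R) : box c r p -> box c r q -> 0 <= t <= 1 ->
  box c r (p + em t *: (q - p)).
Proof.
rewrite /box /= => hp hq ht.
have -> : p + em t *: (q - p) - c = em (1 - t) *: (p - c) + em t *: (q - c).
  by apply: pt_eq; rewrite !ptE rmorphB rmorph1; ring.
apply: le_lt_trans (nmD _ _ _) _; rewrite !nmZ !mdl_emb !ger0_norm; [|lra|lra].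
case: (eqVneq t 0) => [->|t0]; first by rewrite mul0r addr0 subr0 mul1r.
have t0' : 0 < t by lra.
have h1 : t * nm (q - c) < t * r by rewrite ltr_pM2l.
have h2 : (1 - t) * nm (p - c) <= (1 - t) * r by apply: ler_wpM2l; [lra|exact: ltW].
lra.
Qed.

Lemma mean_value_box f c r p q (A B : F) (P Q : pt F -> F) (K : R) :
  (forall s, box c r s -> [/\ hasd f s (P s) (Q s), N (P s - A) <= K & N (Q s - B) <= K]) ->
  box c r p -> box c r q ->
  N (f q - f p - lin2 A B (q - p)) <= 2 * K * nm (q - p).
Proof. by move=> h hp hq; apply: (mean_value (P := P) (Q := Q)) => t ht; apply: h; exact: box_segment. Qed.

Lemma constant_box f c r p q : (forall s, box c r s -> hasd f s 0 0) ->
  box c r p -> box c r q -> f p = f q.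
Proof.
move=> h hp hq.
have := @mean_value_box f c r q p 0 0 (fun=> 0) (fun=> 0) 0.
move=> /(_ _ hq hp) => h2.
have {h2} : N (f p - f q - lin2 0 0 (p - q)) <= 2 * 0 * nm (p - q).
  by apply: h2 => s /h hs; split; rewrite // subrr mdl0.
rewrite /lin2 !mul0r addr0 subr0 mulr0 mul0r => h3.
by apply/eqP; rewrite -subr_eq0; apply/eqP/(mdl0_eq0 (M := M)); apply/eqP; rewrite eq_le h3 mdl_ge0.
Qed.

(** On a segment in [A], the indicator [G] of a relatively open and closed subset is locally
    constant; [curve_growth] with rate 0 makes it constant, and the values 1 and 0 cannot both
    occur. *)
Lemma connected_convex (A : set (pt F)) :
  (forall p q (t : R), A p -> A q -> 0 <= t <= 1 -> A (p + em t *: (q - p))) ->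
  connected A.
Proof.
move=> hA B [p Bp] [C oC BC] [C' cC' BC'].
have BA : B `<=` A by rewrite BC => ? [].
apply/seteqP; split=> // q Aq; have Ap := BA _ Bp.
pose z (t : R) := p + em t *: (q - p); pose G t : F := (`[< B (z t) >])%:R.
have zA t : 0 <= t <= 1 -> A (z t) by exact: hA.
have zc t (D : set (pt F)) : open D -> D (z t) ->
    exists2 d, 0 < d & forall s, `|s - t| < d -> D (z s).
  move=> oD Dz; have [r r0 hr] := open_boxP M oD Dz.
  have n1 : 0 < nm (q - p) + 1 by have := nm_ge0 M (q - p); lra.
  exists (r / (nm (q - p) + 1)); first exact: divr_gt0.
  move=> s; rewrite ltr_pdivlMr // => hs; apply: hr; rewrite /box /=.
  have -> : z s - z t = em (s - t) *: (q - p).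
    by rewrite /z opprD addrACA subrr add0r rmorphB scalerBl.
  rewrite nmZ mdl_emb; apply: le_lt_trans hs; apply: ler_wpM2l => //; lra.
have : N (G 1 - G 0) <= 0.
  apply: curve_growth => t ht.
  have [Bt|Bt] := pselect (B (z t)).
    have [] := @zc t C oC; first by move: Bt; rewrite BC => -[].
    move=> d d0 hd; exists d => // s hs /hd Cs.
    have Bs : B (z s) by rewrite BC; split; [exact: zA|].
    by rewrite /G !asboolT // subrr mdl0 mul0r.
  have [] := @zc t (~` C') (closed_openC cC').
    by move=> C't; apply: Bt; rewrite BC'; split; [exact: zA|].
  move=> d d0 hd; exists d => // s hs /hd Cs.
  have Bs : ~ B (z s) by rewrite BC' => -[].
  by rewrite /G !asboolF // subrr mdl0 mul0r.
have z1 : z 1 = q by rewrite /z rmorph1 scale1r addrC subrK.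
have z0 : z 0 = p by rewrite /z rmorph0 scale0r addr0.
rewrite /G z1 z0 [`[< B p >]]asboolT // => h.
apply: contrapT => nBq; move: h; rewrite asboolF //= sub0r mdlN mdl1; lra.
Qed.

Lemma connected_box c r : connected (box c r).
Proof. by apply: connected_convex => p q t; exact: box_segment. Qed.

End MeanValue.

Section Schwarz.
Variables (R : realType) (F : numFieldType) (M : modulus R F).
Local Notation N := (mdl M).
Local Notation em := (emb M).
Local Notation nm := (nm M).
Local Notation box := (box M).
Implicit Types (p q u v : pt F) (f : pt F -> F) (D : set (pt F)).

Lemma hasd_shift f p v A B : hasd f (p + v) A B -> hasd (fun q => f (q + v)) p A B.
Proof.
move=> /(hasdP M) h; apply/(hasdP M) => e e0; have [d d0 hd] := h e e0.
exists d => // q hq; have := hd (q + v).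
by rewrite /box /= opprD addrACA subrr addr0; apply.
Qed.

(** The increment [g] of [f] over [h *: v] has as gradient the increments of [P] and [Q], which are
    nearly [h * lin2 A B v] and [h * lin2 A' B' v]; the mean value inequality for [g] over [h *: u]
    does the rest. Only differentiability of [P] and [Q] at the single point [p] enters. The
    estimate gives the constant 6; 8 leaves some room. *)
Lemma second_difference D f P Q p u v (A B A' B' : F) : open D -> D p ->
  (forall q, D q -> hasd f q (P q) (Q q)) -> hasd P p A B -> hasd Q p A' B' ->
  nm u <= 1 -> nm v <= 1 -> forall e, 0 < e -> exists2 d, 0 < d &
  forall (t : R) (h : F), 0 < t < d -> h = em t ->
  N (f (p + h *: u + h *: v) - f (p + h *: u) - f (p + h *: v) + f p
     - h * h * lin2 (lin2 A B v) (lin2 A' B' v) u) <= 8 * e * t ^+ 2.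
Proof.
move=> oD Dp f1 h1 h2 u1 v1 e e0.
have aK (x y : pt F) : x + y - x = y by rewrite addrAC subrr add0r.
have [r r0 hr] := open_boxP M oD Dp.
have [d1 d10 hd1] := (hasdP M _ _ _ _).1 h1 e e0.
have [d2 d20 hd2] := (hasdP M _ _ _ _).1 h2 e e0.
pose d := Num.min r (Num.min d1 d2).
have d0 : 0 < d by rewrite !lt_min r0 d10.
(* Two successive steps of length [t] must stay in the box of radius [d]. *)
exists (d / 2); first by lra.
move=> t _ ht ->; set h := em t.
set a := lin2 A B v; set b := lin2 A' B' v.
pose g q := f (q + h *: v) - f q.
have nh w : nm w <= 1 -> nm (h *: w) <= t.
  rewrite nmZ mdl_emb ger0_norm; last by lra.
  by move=> w1; have := ler_wpM2l (_ : 0 <= t) w1; rewrite mulr1; apply; lra.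
have hz (s : R) : 0 <= s <= 1 -> nm (em s *: (h *: u)) <= t.
  move=> hs; rewrite nmZ mdl_emb ger0_norm; last by lra.
  have := ler_wpM2r (nm_ge0 M (h *: u)) (_ : s <= 1).
  by move=> /(_ ltac:(lra)); rewrite mul1r => /le_trans; apply; exact: nh.
(* The two points compared lie within [2 * t] and [t] of [p], so their remainders add up to at most
   [3 * e * t]. *)
have est (G : pt F -> F) C C' w : nm w <= t ->
    (forall q, box p d q -> N (G q - G p - lin2 C C' (q - p)) <= e * nm (q - p)) ->
    N (G (p + w + h *: v) - G (p + w) - h * lin2 C C' v) <= 3 * e * t.
  move=> hw hP; have hhv := nh v v1.
  have e1 : nm (p + w + h *: v - p) <= 2 * t.
    rewrite addrAC [p + w]addrC addrK; apply: le_trans (nmD _ _ _) _; lra.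
  have e2 : nm (p + w - p) <= t by rewrite aK.
  have i1 := hP (p + w + h *: v); have i2 := hP (p + w).
  have {}i1 := i1 ltac:(rewrite /box /=; lra); have {}i2 := i2 ltac:(rewrite /box /=; lra).
  have -> : G (p + w + h *: v) - G (p + w) - h * lin2 C C' v =
    (G (p + w + h *: v) - G p - lin2 C C' (p + w + h *: v - p))
    - (G (p + w) - G p - lin2 C C' (p + w - p)).
    by rewrite !lin2B !lin2D lin2Z; ring.
  apply: le_trans (mdlB _ _ _) _.
  have := ler_wpM2l (ltW e0) e1; have := ler_wpM2l (ltW e0) e2; lra.
have mv := @mean_value _ _ M g p (p + h *: u) (h * a) (h * b)
  (fun q => P (q + h *: v) - P q) (fun q => Q (q + h *: v) - Q q) (3 * e * t).
have dle q : box p d q -> [/\ D q, box p d1 q & box p d2 q].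
  move=> hq; split; [apply: hr | |]; apply: sub_box hq; rewrite /d !ge_min lexx ?orbT //.
have -> : f (p + h *: u + h *: v) - f (p + h *: u) - f (p + h *: v) + f p - h * h * lin2 a b u
   = g (p + h *: u) - g p - lin2 (h * a) (h * b) (p + h *: u - p).
  by rewrite /g aK lin2Z /lin2; ring.
apply: le_trans (mv _) _; last first.
  rewrite aK.
  have := ler_wpM2l (_ : 0 <= 2 * (3 * e * t)) (nh u u1).
  by rewrite expr2 => /(_ ltac:(nra)); nra.
move=> s hs /=; rewrite aK.
have hw := hz s hs; set w := em s *: (h *: u) in hw *.
split.
- apply: hasdB; [apply: hasd_shift|]; apply: f1.
    have [] // := dle (p + w + h *: v).
    rewrite /box /= addrAC [p + w]addrC addrK; apply: le_lt_trans (nmD _ _ _) _.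
    have := nh v v1; lra.
  by have [] // := dle (p + w); rewrite /box /= aK; lra.
- by apply: est => // q /dle[_ + _]; exact: hd1.
- by apply: est => // q /dle[_ _ +]; exact: hd2.
Qed.

(** The second difference is symmetric in the two directions, and [second_difference] approximates
    it by either mixed derivative times [t ^+ 2]. *)
Lemma schwarz D f p : open D -> D p -> Ck 2 D f -> pd1 (pd2 f) p = pd2 (pd1 f) p.
Proof.
move=> oD Dp hf; pose u : pt F := (1, 0); pose v : pt F := (0, 1).
have u1 : nm u <= 1 by rewrite nm_le /= mdl1 mdl0 lexx ler01.
have v1 : nm v <= 1 by rewrite nm_le /= mdl1 mdl0 lexx ler01.
apply/eqP; rewrite -subr_eq0; apply/eqP/(mdl0_eq0 (M := M)); apply/eqP.
rewrite eq_le mdl_ge0 andbT; apply/ler_addgt0Pr => e e0; rewrite add0r.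
(* Each of the two approximations errs by at most [8 * (e / 16) * t ^+ 2]; together they use up
   [e * t ^+ 2]. *)
have e16 : 0 < e / 16 by lra.
have [f1 f2 f3] := hf; have hd q (Dq : D q) := diff_hasd (f1 q Dq).
have k1 := Ck_hasd (n := 0) f2 Dp; have k2 := Ck_hasd (n := 0) f3 Dp.
have [d1 d10 h1] := second_difference oD Dp hd k1 k2 u1 v1 e16.
have [d2 d20 h2] := second_difference oD Dp hd k1 k2 v1 u1 e16.
pose t := Num.min d1 d2 / 2.
have m0 : 0 < Num.min d1 d2 by rewrite lt_min d10.
have m1 : Num.min d1 d2 <= d1 by rewrite ge_min lexx.
have m2 : Num.min d1 d2 <= d2 by rewrite ge_min lexx orbT.
have t0 : 0 < t by rewrite /t; lra.
have {}h1 := h1 t (em t) ltac:(rewrite /t; lra) erefl.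
have {}h2 := h2 t (em t) ltac:(rewrite /t; lra) erefl.
have t2 : 0 < t ^+ 2 by rewrite exprn_gt0.
set X := pd1 (pd2 f) p in h1 h2 *; set Y := pd2 (pd1 f) p in h1 h2 *.
rewrite -(ler_pM2r t2); set h := em t in h1 h2.
have -> : N (X - Y) * t ^+ 2 = N (h * h * (X - Y)).
  by rewrite !mdlM mdl_emb ger0_norm ?(ltW t0) // mulrC expr2.
rewrite [p + h *: v + h *: u]addrAC in h2; move: h1 h2.
set Z := f _; set Z1 := f _; set Z2 := f _; set Z3 := f _.
have l1 (A B A' B' : F) : lin2 (lin2 A B v) (lin2 A' B' v) u = B.
  by rewrite /lin2 /= !mulr0 !mulr1 add0r addr0.
have l2 (A B A' B' : F) : lin2 (lin2 A B u) (lin2 A' B' u) v = A'.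
  by rewrite /lin2 /= !mulr0 !mulr1 add0r addr0.
rewrite l1 l2 => h1 h2.
have -> : h * h * (X - Y) = (Z - Z1 - Z2 + Z3 - h * h * Y) - (Z - Z2 - Z1 + Z3 - h * h * X) by ring.
apply: le_trans (mdlB _ _ _) _; apply: le_trans (lerD h1 h2) _.
rewrite -mulrDl ler_pM2r //; clear -e0; lra.
Qed.

End Schwarz.

(** * Inverse function theorem *)

Section FixedPoint.
Variables (R : realType) (F : numFieldType) (M : modulus R F).
Local Notation N := (mdl M).
Local Notation nm := (nm M).
Local Notation box := (box M).
Implicit Types (p q z : pt F) (h : pt F -> pt F).

Lemma half_pow_small (s e : R) : 0 < e -> exists k, forall n, (k <= n)%N -> s / 2 ^+ n < e.
Proof.
move=> e0; exists (Num.bound (`|s| / e)) => n hn.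
have p0 : 0 < (2 : R) ^+ n by rewrite exprn_gt0.
rewrite ltr_pdivrMr //; apply: le_lt_trans (ler_norm s) _.
rewrite mulrC -ltr_pdivrMr //.
have := archi_boundP (divr_ge0 (normr_ge0 s) (ltW e0)) => /lt_le_trans; apply.
by rewrite -natrX ler_nat; apply: leq_trans hn _; exact: ltnW (ltn_expl _ _).
Qed.

Lemma nm_complete (x : nat -> pt F) :
  (forall e, 0 < e -> exists k, forall m n, (k <= m)%N -> (k <= n)%N -> nm (x m - x n) < e) ->
  exists l, forall e, 0 < e -> exists k, forall n, (k <= n)%N -> nm (x n - l) < e.
Proof.
move=> h.
have [l1 h1] : exists l, forall e, 0 < e -> exists k, forall n, (k <= n)%N -> N ((x n).1 - l) < e.
  apply: mdl_complete => e /h[k hk]; exists k => m n hm hn.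
  exact: le_lt_trans (nm_fst M (x m - x n)) (hk m n hm hn).
have [l2 h2] : exists l, forall e, 0 < e -> exists k, forall n, (k <= n)%N -> N ((x n).2 - l) < e.
  apply: mdl_complete => e /h[k hk]; exists k => m n hm hn.
  exact: le_lt_trans (nm_snd M (x m - x n)) (hk m n hm hn).
exists (l1, l2) => e e0; have [k1 hk1] := h1 e e0; have [k2 hk2] := h2 e e0.
exists (maxn k1 k2) => n; rewrite geq_max => /andP[n1 n2].
by rewrite nm_lt; apply/andP; split; [exact: hk1 | exact: hk2].
Qed.

Section NearIdentity.
Variables (h : pt F -> pt F) (p0 : pt F) (r : R).
Hypothesis hh : forall p q, box p0 r p -> box p0 r q ->
  nm (h q - h p - (q - p)) <= 1 / 2 * nm (q - p).

Lemma near_identity_lower p q : box p0 r p -> box p0 r q -> nm (q - p) <= 2 * nm (h q - h p).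
Proof.
move=> hp hq; have := hh hp hq; have := nmBD M (q - p) (h q - h p) 0.
by rewrite !subr0 (nmC M (q - p)); clear; lra.
Qed.

(** Picard iteration of [T], a contraction of ratio [1 / 2] whose fixed points solve [h p = z]. The
    n-th step has length at most [s / 2 ^+ n], so the iterates stay within [2 * s < r / 2] of
    [p0]. *)
Lemma near_identity_surj z : nm (z - h p0) < r / 4 -> exists2 p, box p0 r p & h p = z.
Proof.
move=> hz; set s := nm (z - h p0) in hz.
have s0 : 0 <= s := nm_ge0 M _.
pose T p := p + (z - h p); pose x n := iter n T p0.
have TB p q : box p0 r p -> box p0 r q -> nm (T q - T p) <= 1 / 2 * nm (q - p).
  move=> hp hq; have := hh hp hq; rewrite -nmN; congr (nm _ <= _).
  by apply: pt_eq; rewrite /T !ptE -/(GRing.opp _) /=; ring.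
have half n : s / 2 ^+ n.+1 = 1 / 2 * (s / 2 ^+ n).
  by rewrite exprS invfM; ring.
have hx n : nm (x n - p0) <= 2 * (s - s / 2 ^+ n) /\ nm (x n.+1 - x n) <= s / 2 ^+ n.
  have p2 k : 0 <= s / 2 ^+ k by rewrite divr_ge0 // exprn_ge0.
  elim: n => [|n [IH1 IH2]].
    rewrite expr0 divr1 subrr nm0 subrr mulr0; split=> //.
    by rewrite /x /= /T addrAC subrr add0r.
  have h1 : nm (x n.+1 - p0) <= 2 * (s - s / 2 ^+ n.+1).
    apply: le_trans (nmBD _ _ (x n) _) _; rewrite half; lra.
  split=> //; have b1 : box p0 r (x n) by rewrite /box /=; have := p2 n; lra.
  have b2 : box p0 r (x n.+1) by rewrite /box /=; have := p2 n.+1; lra.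
  by apply: le_trans (TB _ _ b1 b2) _; rewrite half; lra.
have xx n k : nm (x (n + k)%N - x n) <= 2 * (s / 2 ^+ n - s / 2 ^+ (n + k)).
  elim: k => [|k IH]; first by rewrite addn0 !subrr nm0 mulr0.
  apply: le_trans (nmBD _ _ (x (n + k)%N) _) _; rewrite addnS.
  by have := (hx (n + k)%N).2; rewrite half; lra.
have p2 k : 0 <= s / 2 ^+ k by rewrite divr_ge0 // exprn_ge0.
have xc n m : (n <= m)%N -> nm (x m - x n) <= 2 * (s / 2 ^+ n).
  by move=> nm'; have := xx n (m - n)%N; rewrite subnKC // => H; have := p2 m; lra.
have [l hl] : exists l, forall e, 0 < e -> exists k, forall n, (k <= n)%N -> nm (x n - l) < e.
  apply: nm_complete => e e0; have e4 : 0 < e / 4 by lra.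
  have [k hk] := half_pow_small s e4; exists k => m n hm hn.
  apply: le_lt_trans (nmBD _ _ (x k) _) _; rewrite (nmC _ (x k)).
  by have := xc k m hm; have := xc k n hn; have := hk k (leqnn k); lra.
(* The iterates stay within [r / 2]; adding an error [r / 4] keeps the limit strictly inside the
   box. *)
have bl : box p0 r l.
  have e0 : 0 < r / 4 by lra.
  have [k hk] := hl _ e0; have := hk k (leqnn k); rewrite nmC => h1.
  rewrite /box /=; apply: le_lt_trans (nmBD _ _ (x k) _) _.
  by have := (hx k).1; have := p2 k; lra.
(* The residual [z - h l] is compared with the residual at an iterate [x k], which is just the next
   step of the iteration. *)
exists l => //; apply/eqP; rewrite eq_sym -subr_eq0; apply/eqP/(nm0_eq0 (M := M)).
apply/eqP; rewrite eq_le nm_ge0 andbT; apply/ler_addgt0Pr => e e0; rewrite add0r.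
have e4 : 0 < e / 4 by lra.
have [k1 hk1] := half_pow_small s e4; have [k2 hk2] := hl _ e4.
pose k := maxn k1 k2.
have {}hk1 := hk1 k (leq_maxl _ _); have {}hk2 := hk2 k (leq_maxr _ _).
have bk : box p0 r (x k) by rewrite /box /=; have := (hx k).1; have := p2 k; lra.
have i1 := hh bl bk; have i2 := (hx k).2.
have -> : z - h l = (x k.+1 - x k) + (h (x k) - h l - (x k - l)) + (x k - l).
  by rewrite [x k.+1]/(x k + (z - h (x k))); apply: pt_eq; rewrite !ptE; ring.
apply: le_trans (nmD _ _ _) _; have := nmD M (x k.+1 - x k) (h (x k) - h l - (x k - l)).
lra.
Qed.

End NearIdentity.
End FixedPoint.

Section InverseFunction.
Variables (R : realType) (F : numFieldType) (M : modulus R F).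
Local Notation N := (mdl M).
Local Notation nm := (nm M).
Local Notation box := (box M).
Implicit Types (p q y : pt F) (f : pt F -> F) (D : set (pt F)).

Lemma continuous_box f p (e : R) : {for p, continuous f} -> 0 < e ->
  exists2 d, 0 < d & forall q, box p d q -> N (f q - f p) <= e.
Proof.
by move=> /(continuous_mdlP M) h /h[d d0 hd]; exists d => // q /hd /ltW.
Qed.

Lemma continuous_neq0 f p : {for p, continuous f} -> f p != 0 ->
  exists2 d, 0 < d & forall q, box p d q -> f q != 0.
Proof.
move=> /(continuous_mdlP M) h; rewrite -(mdl_gt0 M) => /h[d d0 hd].
exists d => // q /hd; apply: contraTneq => ->.
by rewrite sub0r mdlN ltxx.
Qed.

Definition jac (f g : pt F -> F) p : F := pd1 f p * pd2 g p - pd2 f p * pd1 g p.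

(* Cramer's rule applied to the defining estimate of the derivative. *)
Lemma hasd_inverse (g1 g2 s1 s2 : pt F -> F) y p (A B A' B' : F) (L : R) :
  hasd g1 p A B -> hasd g2 p A' B' -> A * B' - B * A' != 0 -> 0 < L ->
  p = (s1 y, s2 y) ->
  (exists2 d, 0 < d & forall z, box y d z ->
     [/\ g1 (s1 z, s2 z) = z.1, g2 (s1 z, s2 z) = z.2 &
         nm ((s1 z, s2 z) - p) <= L * nm (z - y)]) ->
  hasd s1 y (B' / (A * B' - B * A')) (- B / (A * B' - B * A')) /\
  hasd s2 y (- A' / (A * B' - B * A')) (A / (A * B' - B * A')).
Proof.
move=> /(hasdP M) h1 /(hasdP M) h2; set J := A * B' - B * A' => J0 L0 py [d d0 hd].
have NJ : 0 < N J by rewrite mdl_gt0.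
pose C := N A + N B + N A' + N B' + 1.
have C0 : 0 < C.
  rewrite /C; have := mdl_ge0 M A; have := mdl_ge0 M B.
  by have := mdl_ge0 M A'; have := mdl_ge0 M B'; lra.
have [yy1 yy2 _] := hd y (box_center M y d0); rewrite -py in yy1 yy2.
have main e : 0 < e -> exists2 d, 0 < d & forall z, box y d z ->
    let w := (s1 z, s2 z) - p in
    [/\ N (z.1 - y.1 - lin2 A B w) <= e * nm (z - y),
        N (z.2 - y.2 - lin2 A' B' w) <= e * nm (z - y) & True].
  move=> e0; have eL : 0 < e / L by rewrite divr_gt0.
  have [d1 d10 hd1] := h1 _ eL; have [d2 d20 hd2] := h2 _ eL.
  pose m := Num.min d1 d2; have m0 : 0 < m by rewrite lt_min d10.
  exists (Num.min d (m / L)); first by rewrite lt_min d0 divr_gt0.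
  move=> z; rewrite /box /= lt_min => /andP[z1 z2].
  have [zz1 zz2 hz] := hd z z1; rewrite ltr_pdivlMr // in z2.
  have hm : nm ((s1 z, s2 z) - p) < m by apply: le_lt_trans hz _; rewrite mulrC.
  have b1 : box p d1 (s1 z, s2 z) by apply: lt_le_trans hm _; rewrite /m ge_min lexx.
  have b2 : box p d2 (s1 z, s2 z) by apply: lt_le_trans hm _; rewrite /m ge_min lexx orbT.
  have eh : e / L * nm ((s1 z, s2 z) - p) <= e * nm (z - y).
    rewrite mulrAC ler_pdivrMr // -mulrA; apply: ler_wpM2l; first exact: ltW.
    by rewrite mulrC.
  split=> //.
    by have := hd1 _ b1; rewrite zz1 yy1 => /le_trans; apply.
  by have := hd2 _ b2; rewrite zz2 yy2 => /le_trans; apply.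
have est (a b x1 x2 : F) (c : R) : N a <= C -> N b <= C -> N x1 <= c -> N x2 <= c ->
    N ((a * x1 + b * x2) / J) <= 2 * C * c / N J.
  move=> ha hb hx1 hx2; rewrite mdlM mdlV; apply: ler_wpM2r; first by rewrite invr_ge0 ltW.
  apply: le_trans (mdlD _ _ _) _; rewrite !mdlM.
  have := ler_pM (mdl_ge0 M a) (mdl_ge0 M x1) ha hx1.
  have := ler_pM (mdl_ge0 M b) (mdl_ge0 M x2) hb hx2; clear; lra.
have [cA cB cA' cB'] : [/\ N A <= C, N B <= C, N A' <= C & N B' <= C].
  rewrite /C; have := mdl_ge0 M A; have := mdl_ge0 M B.
  by have := mdl_ge0 M A'; have := mdl_ge0 M B'; clear; split; lra.
have fin (s : pt F -> F) P Q :
    (forall z, exists a b, [/\ N a <= C, N b <= C & s z - s y - lin2 P Q (z - y) =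
      (a * (z.1 - y.1 - lin2 A B ((s1 z, s2 z) - p)) +
       b * (z.2 - y.2 - lin2 A' B' ((s1 z, s2 z) - p))) / J]) -> hasd s y P Q.
  move=> hs; apply/(hasdP M) => e e0.
  have e' : 0 < e * N J / (2 * C) by rewrite divr_gt0 ?mulr_gt0.
  have [d1 d10 hd1] := main _ e'; exists d1 => // z /hd1[i1 i2 _].
  have [a [b [ha hb ->]]] := hs z.
  apply: le_trans (est _ _ _ _ _ ha hb i1 i2) _.
  rewrite le_eqVlt; apply/orP; left; apply/eqP; field.
  by rewrite (gt_eqF NJ) (gt_eqF C0).
split; apply: fin => z.
  exists (- B'), B; split; rewrite ?mdlN //.
  by rewrite py /lin2 !ptE /= /J; field.
exists A', (- A); split; rewrite ?mdlN //.
by rewrite py /lin2 !ptE /= /J; field.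
Qed.

End InverseFunction.

Section InverseFunctionTheorem.
Variables (R : realType) (F : numFieldType) (M : modulus R F).
Local Notation N := (mdl M).
Local Notation nm := (nm M).
Local Notation box := (box M).
Implicit Types (p q y : pt F) (f : pt F -> F) (D U V : set (pt F)).

(** Component functions are used in place of maps to the plane: this is the form in which
    [hasd_comp] and [smooth_comp] take an inner map. *)
Record chart U V (g1 g2 s1 s2 : pt F -> F) : Prop := Chart {
  chart_open1 : open U;
  chart_open2 : open V;
  chart_fwd1 : smooth U g1;
  chart_fwd2 : smooth U g2;
  chart_bwd1 : smooth V s1;
  chart_bwd2 : smooth V s2;
  chart_to : forall p, U p -> V (g1 p, g2 p);
  chart_from : forall y, V y -> U (s1 y, s2 y);
  chart_toK : forall p, U p -> (s1 (g1 p, g2 p), s2 (g1 p, g2 p)) = p;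
  chart_fromK : forall y, V y -> (g1 (s1 y, s2 y), g2 (s1 y, s2 y)) = y
}.

Lemma open_preimage U V g1 g2 : open U -> open V ->
  (forall p, U p -> {for p, continuous g1}) -> (forall p, U p -> {for p, continuous g2}) ->
  open [set p | U p /\ V (g1 p, g2 p)].
Proof.
move=> oU oV c1 c2; rewrite openE => p [Up Vp].
have [r r0 hr] := open_boxP M oU Up; have [s s0 hs] := open_boxP M oV Vp.
have [d1 d10 h1] := (continuous_mdlP M _ _).1 (c1 p Up) s s0.
have [d2 d20 h2] := (continuous_mdlP M _ _).1 (c2 p Up) s s0.
apply/(nbhs_boxP M); exists (Num.min r (Num.min d1 d2)); first by rewrite !lt_min r0 d10.
move=> q; rewrite /box /= !lt_min => /and3P[q1 q2 q3]; split; first exact: hr.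
by apply: hs; rewrite /box /= nm_lt h1 // h2.
Qed.

(** Composition with the inverse Jacobian matrix at [p0], given by [B1] and [B2], yields a map [h]
    whose differential at [p0] is the identity, hence one close to the identity on a small box. The
    target is a full box so that the new domain is convex. *)
Lemma inverse_function_theorem D g1 g2 p0 : open D -> D p0 ->
  smooth D g1 -> smooth D g2 -> jac g1 g2 p0 != 0 ->
  exists rho U s1 s2, [/\ 0 < rho, U p0, U `<=` D &
    chart U (box (g1 p0, g2 p0) rho) g1 g2 s1 s2].
Proof.
move=> oD Dp0 sg1 sg2 J0.
pose a := pd1 g1 p0; pose b := pd2 g1 p0; pose c := pd1 g2 p0; pose d := pd2 g2 p0.
pose J := a * d - b * c; have {}J0 : J != 0 by [].
pose B1 := lin2 (d / J) (- b / J); pose B2 := lin2 (- c / J) (a / J).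
pose h q : pt F := (B1 (g1 q, g2 q), B2 (g1 q, g2 q)).
have hd1 q : D q -> hasd g1 q (pd1 g1 q) (pd2 g1 q) := smooth_hasd sg1.
have hd2 q : D q -> hasd g2 q (pd1 g2 q) (pd2 g2 q) := smooth_hasd sg2.
pose K (x y : F) (f1 f2 : pt F -> F) q := x * f1 q + y * f2 q.
have Kc (x x0 : F) f1 f2 : smooth D f1 -> smooth D f2 -> {for p0, continuous (K x x0 f1 f2)}.
  move=> s1 s2; apply: smooth_continuous Dp0.
  by apply: (smoothD M oD); apply: (smoothM M oD) => //; exact: (smooth_cst M).
(* Each partial derivative of [h] is kept within [1 / 4] of its value at [p0]; [mean_value_box]
   doubles this into the [1 / 2] of the near-identity lemmas. *)
have e4 : (0 : R) < 1 / 4 by lra.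
have sp1 := smooth_pd1 sg1; have sp2 := smooth_pd2 sg1.
have sp3 := smooth_pd1 sg2; have sp4 := smooth_pd2 sg2.
have [r1 r10 h1] := continuous_box M (Kc (d / J) (- b / J) _ _ sp1 sp3) e4.
have [r2 r20 h2] := continuous_box M (Kc (d / J) (- b / J) _ _ sp2 sp4) e4.
have [r3 r30 h3] := continuous_box M (Kc (- c / J) (a / J) _ _ sp1 sp3) e4.
have [r4 r40 h4] := continuous_box M (Kc (- c / J) (a / J) _ _ sp2 sp4) e4.
have sJ : smooth D (jac g1 g2).
  by apply: (smoothB M oD); apply: (smoothM M oD).
have [r5 r50 h5] := continuous_neq0 M (smooth_continuous sJ Dp0) J0.
have [r6 r60 h6] := open_boxP M oD Dp0.
pose r := Num.min r1 (Num.min r2 (Num.min r3 (Num.min r4 (Num.min r5 r6)))).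
have r0 : 0 < r by rewrite !lt_min r10 r20 r30 r40 r50.
have br q : box p0 r q -> [/\ box p0 r1 q, box p0 r2 q, box p0 r3 q & box p0 r4 q] /\
    box p0 r5 q /\ box p0 r6 q.
  by rewrite /box /= !lt_min => /and5P[? ? ? ? /andP[? ?]].
have rD : box p0 r `<=` D by move=> q /br[_ [_ /h6]].
have k1 : K (d / J) (- b / J) (pd1 g1) (pd1 g2) p0 = 1.
  by rewrite /K -/a -/c /J; field.
have k2 : K (d / J) (- b / J) (pd2 g1) (pd2 g2) p0 = 0.
  by rewrite /K -/b -/d /J; field.
have k3 : K (- c / J) (a / J) (pd1 g1) (pd1 g2) p0 = 0.
  by rewrite /K -/a -/c /J; field.
have k4 : K (- c / J) (a / J) (pd2 g1) (pd2 g2) p0 = 1.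
  by rewrite /K -/b -/d /J; field.
rewrite k1 in h1; rewrite k2 in h2; rewrite k3 in h3; rewrite k4 in h4.
have hh p q : box p0 r p -> box p0 r q -> nm (h q - h p - (q - p)) <= 1 / 2 * nm (q - p).
  move=> bp bq; have e2 : 1 / 2 = 2 * (1 / 4) :> R by lra.
  rewrite nm_le e2; apply/andP; split.
    have -> : (h q - h p - (q - p)).1 =
       B1 (g1 q, g2 q) - B1 (g1 p, g2 p) - lin2 1 0 (q - p).
      by rewrite /lin2 mul1r mul0r addr0.
    apply: (mean_value_box (f := fun q => B1 (g1 q, g2 q)) _ bp bq) => s bs.
    have Ds := rD s bs; have [[i1 i2 i3 i4] [i5 i6]] := br s bs.
    by split; [exact: (hasd_comp (hasd_lin2 M _ _ _) (hd1 s Ds) (hd2 s Ds)) | exact: h1 | exact: h2].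
  have -> : (h q - h p - (q - p)).2 =
       B2 (g1 q, g2 q) - B2 (g1 p, g2 p) - lin2 0 1 (q - p).
    by rewrite /lin2 mul1r mul0r add0r.
  apply: (mean_value_box (f := fun q => B2 (g1 q, g2 q)) _ bp bq) => s bs.
  have Ds := rD s bs; have [[i1 i2 i3 i4] [i5 i6]] := br s bs.
  by split; [exact: (hasd_comp (hasd_lin2 M _ _ _) (hd1 s Ds) (hd2 s Ds)) | exact: h3 | exact: h4].
pose C := N (d / J) + N (- b / J) + (N (- c / J) + N (a / J)) + 1.
have C0 : 0 < C.
  rewrite /C; have := mdl_ge0 M (d / J); have := mdl_ge0 M (- b / J).
  by have := mdl_ge0 M (- c / J); have := mdl_ge0 M (a / J); clear; lra.
pose B y : pt F := (B1 y, B2 y).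
have BC y z : nm (B y - B z) <= C * nm (y - z).
  have n0 := nm_ge0 M (y - z).
  rewrite nm_le; apply/andP; split.
    have -> : (B y - B z).1 = B1 (y - z) by rewrite /B1 lin2B.
    apply: le_trans (lin2_bound M _ _ _) _; apply: ler_wpM2r => //; rewrite /C.
    by have := mdl_ge0 M (- c / J); have := mdl_ge0 M (a / J); clear; lra.
  have -> : (B y - B z).2 = B2 (y - z) by rewrite /B2 lin2B.
  apply: le_trans (lin2_bound M _ _ _) _; apply: ler_wpM2r => //; rewrite /C.
  by have := mdl_ge0 M (d / J); have := mdl_ge0 M (- b / J); clear; lra.
have Bi y z : B y = B z -> y = z.
  case: y z => [y1 y2] [z1 z2] [e1 e2].
  have e3 : a * B1 (y1, y2) + b * B2 (y1, y2) = a * B1 (z1, z2) + b * B2 (z1, z2).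
    by rewrite e1 e2.
  have e5 : c * B1 (y1, y2) + d * B2 (y1, y2) = c * B1 (z1, z2) + d * B2 (z1, z2).
    by rewrite e1 e2.
  have f1 x x' : a * B1 (x, x') + b * B2 (x, x') = x by rewrite /B1 /B2 /lin2 /= /J; field.
  have f2 x x' : c * B1 (x, x') + d * B2 (x, x') = x' by rewrite /B1 /B2 /lin2 /= /J; field.
  by rewrite !f1 in e3; rewrite !f2 in e5; rewrite e3 e5.
pose y0 : pt F := (g1 p0, g2 p0).
(* [B] is Lipschitz with constant [C], so it sends the box of radius [rho] within [r / 4] of [h p0],
   the range reached by [near_identity_surj]. *)
pose rho := r / 4 / C; have rho0 : 0 < rho by rewrite !divr_gt0.
have ex y : box y0 rho y -> exists p, box p0 r p /\ (g1 p, g2 p) = y.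
  move=> hy; have [|p bp hp] := @near_identity_surj _ _ M h p0 r hh (B y).
    by apply: le_lt_trans (BC y y0) _; rewrite mulrC -ltr_pdivlMr.
  by exists p; split=> //; apply: Bi.
pose psi y := xget p0 [set p | box p0 r p /\ (g1 p, g2 p) = y].
have psiP y : box y0 rho y -> box p0 r (psi y) /\ (g1 (psi y), g2 (psi y)) = y.
  by move=> /ex[p hp]; rewrite /psi; case: xgetP => [q _ //|/(_ p)].
have psi_uniq p : box p0 r p -> box y0 rho (g1 p, g2 p) -> psi (g1 p, g2 p) = p.
  move=> bp by_; have [bq eq] := psiP _ by_.
  apply/eqP; rewrite -subr_eq0; apply/eqP/(nm0_eq0 (M := M))/eqP.
  rewrite eq_le nm_ge0 andbT; apply: le_trans (near_identity_lower hh bp bq) _.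
  by rewrite /h eq subrr nm0 mulr0.
pose s1 y := (psi y).1; pose s2 y := (psi y).2.
have sE y : (s1 y, s2 y) = psi y by rewrite /s1 /s2 -surjective_pairing.
pose U := [set p | box p0 r p /\ box y0 rho (g1 p, g2 p)].
have oU : open U.
  apply: open_preimage; [exact: open_box | exact: open_box | |] => p /rD Dp.
    exact: smooth_continuous sg1 Dp.
  exact: smooth_continuous sg2 Dp.
have UD : U `<=` D by move=> p [/rD].
have oB : open (box p0 r) := @open_box _ _ M p0 r.
have oV : open (box y0 rho) := @open_box _ _ M y0 rho.
have sB f : smooth D f -> smooth (box p0 r) f by exact: smooth_sub.
have sV (f : pt F -> F) (x : F) : smooth D f -> smooth (box p0 r) (fun q => x * f q / jac g1 g2 q).
  move=> sf; apply: (smoothF M oB); [by move=> p /br[_ [/h5]] | | exact: sB].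
  by apply: (smoothM M oB); [exact: (smooth_cst M) | exact: sB].
have hasd_s y : box y0 rho y -> let p := (s1 y, s2 y) in
    hasd s1 y (pd2 g2 p / jac g1 g2 p) (- pd2 g1 p / jac g1 g2 p) /\
    hasd s2 y (- pd1 g2 p / jac g1 g2 p) (pd1 g1 p / jac g1 g2 p).
  move=> Vy p; have [bp gp] := psiP y Vy; rewrite -sE -/p in bp gp.
  have Dp := rD p bp; have [_ [i5 _]] := br p bp.
  (* The inverse map is Lipschitz: the factor 2 is that of [near_identity_lower], and [C] that of
     [B]. *)
  apply: (hasd_inverse (L := 2 * C) (hd1 p Dp) (hd2 p Dp) (h5 p i5)) => //.
    by rewrite mulr_gt0.
  have [t t0 ht] := open_boxP M oV Vy; exists t => // z /ht Vz.
  have [bz gz] := psiP z Vz; rewrite sE; split; [by rewrite -[in RHS]gz | by rewrite -[in RHS]gz|].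
  apply: le_trans (near_identity_lower hh bp bz) _; rewrite -mulrA; apply: ler_wpM2l => //.
  by have := BC z y; rewrite -[in B z]gz -[in B y]gp.
(* Bootstrap: [hasd_s] expresses the partial derivatives of [s1] and [s2] through smooth functions
   evaluated at [(s1, s2)], so one order of regularity of the pair yields the next. Both components
   have to advance together. *)
have sP n : Ck n (box y0 rho) s1 /\ Ck n (box y0 rho) s2.
  elim: n => [|n [IH1 IH2]].
    by split=> y Vy; have [hs1 hs2] := hasd_s y Vy; [exact: hasd_continuous hs1 | exact: hasd_continuous hs2].
  have cc (x : F) f : smooth D f ->
      Ck n (box y0 rho) (fun y => x * f (s1 y, s2 y) / jac g1 g2 (s1 y, s2 y)).
    move=> sf; apply: (Ck_comp M oV oB _ (sV f x sf n) IH1 IH2) => y Vy.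
    by rewrite sE; have [] := psiP y Vy.
  split.
    apply: (Ck_step M oV _ (cc 1 _ sp4) (cc (-1) _ sp2)) => y Vy.
    by have [+ _] := hasd_s y Vy; apply: hasd_ext; rewrite ?mul1r ?mulN1r.
  apply: (Ck_step M oV _ (cc (-1) _ sp3) (cc 1 _ sp1)) => y Vy.
  by have [_ +] := hasd_s y Vy; apply: hasd_ext; rewrite ?mul1r ?mulN1r.
exists rho, U, s1, s2; split=> //.
  by split; [exact: box_center | exact: box_center].
split=> //.
- exact: smooth_sub UD sg1.
- exact: smooth_sub UD sg2.
- by move=> n; have [] := sP n.
- by move=> n; have [] := sP n.
- by move=> p [].
- by move=> y Vy; rewrite sE; have [bp gp] := psiP y Vy; split; rewrite ?gp.
- by move=> p [bp Vp]; rewrite sE; exact: psi_uniq.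
- by move=> y Vy; rewrite sE; have [] := psiP y Vy.
Qed.

End InverseFunctionTheorem.

(** * Primitives and integrating factors *)

Section Primitives.
Variables (R : realType) (F : numFieldType) (M : modulus R F).
Local Notation N := (mdl M).
Local Notation em := (emb M).
Local Notation nm := (nm M).
Local Notation box := (box M).
Implicit Types (p q v : pt F) (f : pt F -> F) (D : set (pt F)).

Lemma harmonic_small (C e : R) : 0 < e ->
  exists k, forall n, (k <= n)%N -> C / n.+1%:R < e.
Proof.
move=> e0; exists (Num.bound (`|C| / e)) => n hn.
rewrite ltr_pdivrMr ?ltr0Sn //; apply: le_lt_trans (ler_norm C) _.
rewrite mulrC -ltr_pdivrMr //.
have := archi_boundP (divr_ge0 (normr_ge0 C) (ltW e0)) => /lt_le_trans; apply.
by rewrite ler_nat; apply: leq_trans hn _.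
Qed.

Lemma le_limit (x : nat -> F) (l : F) (c : R) (C : R) :
  (forall e, 0 < e -> exists k, forall n, (k <= n)%N -> N (x n - l) < e) ->
  (forall n, N (x n) <= c + C / n.+1%:R) -> N l <= c.
Proof.
move=> hx hc; apply/ler_addgt0Pr => e e0; have e2 : 0 < e / 2 by lra.
have [k1 h1] := hx _ e2; have [k2 h2] := harmonic_small C e2.
have {}h1 := h1 (maxn k1 k2) (leq_maxl _ _); have {}h2 := h2 (maxn k1 k2) (leq_maxr _ _).
have h3 := hc (maxn k1 k2).
have := mdlB M (x (maxn k1 k2)) (x (maxn k1 k2) - l).
have -> : x (maxn k1 k2) - (x (maxn k1 k2) - l) = l by ring.
move: h1 h2 h3; set z := C / _; clear -e0; lra.
Qed.

(** The mean value inequality is used twice: for [E m - E n], it makes the values Cauchy because all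
    [E n] agree at [p0]; for a single [E n] against the linear map [lin2 (P s) (Q s)], it gives a
    differentiability estimate uniform enough in [n] to survive the limit. *)
Lemma uniform_primitive p0 r (E P_ Q_ : nat -> pt F -> F) (P Q : pt F -> F) (C : R) :
  0 < r ->
  (forall n, E n p0 = 0) ->
  (forall n s, box p0 r s -> [/\ hasd (E n) s (P_ n s) (Q_ n s),
     N (P_ n s - P s) <= C / n.+1%:R & N (Q_ n s - Q s) <= C / n.+1%:R]) ->
  (forall s, box p0 r s -> {for s, continuous P} /\ {for s, continuous Q}) ->
  exists f, f p0 = 0 /\ forall s, box p0 r s -> hasd f s (P s) (Q s).
Proof.
move=> r0 E0 hE hPQ.
have C0 : 0 <= C.
  have [_ + _] := hE 0%N p0 (box_center M p0 r0); rewrite divr1.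
  exact: le_trans (mdl_ge0 _ _).
have cauchy s : box p0 r s -> forall m n,
    N (E m s - E n s) <= 2 * (C / m.+1%:R + C / n.+1%:R) * nm (s - p0).
  move=> bs m n.
  have := @mean_value_box _ _ M (fun q => E m q - E n q) p0 r p0 s 0 0
    (fun q => P_ m q - P_ n q) (fun q => Q_ m q - Q_ n q) (C / m.+1%:R + C / n.+1%:R).
  have -> : E m s - E n s - (E m p0 - E n p0) - lin2 0 0 (s - p0) = E m s - E n s.
    by rewrite !E0 /lin2 !mul0r; ring.
  apply; [|exact: box_center|exact: bs].
  move=> q /[dup] /(hE m)[m1 m2 m3] /(hE n)[n1 n2 n3]; split.
  - exact: hasdB.
  - have -> : P_ m q - P_ n q - 0 = (P_ m q - P q) - (P_ n q - P q) by ring.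
    by apply: le_trans (mdlB _ _ _) _; exact: lerD.
  - have -> : Q_ m q - Q_ n q - 0 = (Q_ m q - Q q) - (Q_ n q - Q q) by ring.
    by apply: le_trans (mdlB _ _ _) _; exact: lerD.
have lim s : exists l, box p0 r s ->
    forall e, 0 < e -> exists k, forall n, (k <= n)%N -> N (E n s - l) < e.
  have [bs|] := pselect (box p0 r s); last by move=> h; exists 0.
  have [e e0|l hl] := @mdl_complete _ _ M (fun n => E n s); last by exists l.
  have [k hk] := harmonic_small (4 * C * nm (s - p0)) e0.
  have {}hk := hk k (leqnn k).
  exists k => m n hm hn; apply: le_lt_trans (cauchy s bs m n) _.
  apply: le_lt_trans hk.
  have n0 := nm_ge0 M (s - p0).
  have mono i : (k <= i)%N -> C / i.+1%:R <= C / k.+1%:R.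
    by move=> ki; rewrite ler_wpM2l // lef_pV2 ?posrE ?ltr0Sn // ler_nat.
  have -> : 4 * C * nm (s - p0) / k.+1%:R =
    2 * (C / k.+1%:R + C / k.+1%:R) * nm (s - p0) by ring.
  by apply: ler_wpM2r => //; apply: ler_wpM2l => //; apply: lerD; exact: mono.
pose f s := xget 0 [set l | box p0 r s ->
    forall e, 0 < e -> exists k, forall n, (k <= n)%N -> N (E n s - l) < e].
have fP s : box p0 r s -> forall e, 0 < e ->
    exists k, forall n, (k <= n)%N -> N (E n s - f s) < e.
  rewrite /f; case: xgetP => [l _ //|h]; have [l hl] := lim s.
  by case: (h l).
exists f; split.
  apply/(mdl0_eq0 (M := M)); apply/eqP; rewrite eq_le mdl_ge0 andbT.
  apply: (le_limit (x := fun n => E n p0) (C := 0)  (fP p0 (box_center M p0 r0))).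
  by move=> n; rewrite E0 mdl0 mul0r addr0.
move=> s bs; apply/(hasdP M) => e e0.
have [c1 c2] := hPQ s bs; have e4 : 0 < e / 4 by lra.
have [d1 d10 h1] := continuous_box M c1 e4; have [d2 d20 h2] := continuous_box M c2 e4.
have [d3 d30 h3] := open_boxP M (@open_box _ _ M p0 r) bs.
pose d := Num.min d1 (Num.min d2 d3).
have d0 : 0 < d by rewrite !lt_min d10 d20.
exists d => // q bq.
have dq z : box s d z -> [/\ box s d1 z, box s d2 z & box p0 r z].
  by rewrite /box /= !lt_min => /and3P[? ? ?]; split=> //; exact: h3.
have [_ _ bq0] := dq q bq; have n0 := nm_ge0 M (q - s).
apply: (le_limit (x := fun n => E n q - E n s - lin2 (P s) (Q s) (q - s))
  (C := 2 * C * nm (q - s)) ).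
  move=> e' e'0; have e2 : 0 < e' / 2 by lra.
  have [k1 hk1] := fP q bq0 _ e2; have [k2 hk2] := fP s bs _ e2.
  exists (maxn k1 k2) => n; rewrite geq_max => /andP[/hk1 i1 /hk2 i2].
  have -> : E n q - E n s - lin2 (P s) (Q s) (q - s) - (f q - f s - lin2 (P s) (Q s) (q - s))
    = (E n q - f q) - (E n s - f s) by ring.
  by apply: le_lt_trans (mdlB _ _ _) _; lra.
move=> n.
have -> : e * nm (q - s) + 2 * C * nm (q - s) / n.+1%:R =
   (e + 2 * (C / n.+1%:R)) * nm (q - s) by ring.
apply: le_trans (_ : 2 * (e / 4 + C / n.+1%:R) * nm (q - s) <= _).
  apply: (mean_value_box (P := P_ n) (Q := Q_ n)) bq; last exact: box_center.
  move=> z /dq[z1 z2 z3]; have [g1 g2 g3] := hE n z z3; split => //.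
    have -> : P_ n z - P s = (P z - P s) + (P_ n z - P z) by ring.
    by apply: le_trans (mdlD _ _ _) _; apply: lerD => //; exact: h1.
  have -> : Q_ n z - Q s = (Q z - Q s) + (Q_ n z - Q z) by ring.
  by apply: le_trans (mdlD _ _ _) _; apply: lerD => //; exact: h2.
by apply: ler_wpM2r => //; clear -e0; set x := C / _; lra.
Qed.

End Primitives.

Section Poincare.
Variables (R : realType) (F : numFieldType) (M : modulus R F).
Local Notation N := (mdl M).
Local Notation em := (emb M).
Local Notation nm := (nm M).
Local Notation box := (box M).
Implicit Types (p q v : pt F) (f : pt F -> F) (D : set (pt F)).

Lemma bounded_box f p : {for p, continuous f} ->
  exists B d, 0 < d /\ forall q, box p d q -> N (f q) <= B.
Proof.
move=> cf; have [d d0 hd] := continuous_box M cf ltr01.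
exists (N (f p) + 1), d; split=> // q /hd h.
have -> : f q = f p + (f q - f p) by ring.
by apply: le_trans (mdlD _ _ _) _; rewrite lerD2l.
Qed.

Lemma bounded_box6 (f1 f2 f3 f4 f5 f6 : pt F -> F) p :
  [/\ {for p, continuous f1}, {for p, continuous f2} & {for p, continuous f3}] ->
  [/\ {for p, continuous f4}, {for p, continuous f5} & {for p, continuous f6}] ->
  exists B d, 0 < d /\ forall q, box p d q ->
    [/\ N (f1 q) <= B, N (f2 q) <= B & [/\ N (f3 q) <= B, N (f4 q) <= B,
        N (f5 q) <= B & N (f6 q) <= B]].
Proof.
move=> [/bounded_box[B1 [d1 [d10 h1]]] /bounded_box[B2 [d2 [d20 h2]]]
  /bounded_box[B3 [d3 [d30 h3]]]] [/bounded_box[B4 [d4 [d40 h4]]]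
  /bounded_box[B5 [d5 [d50 h5]]] /bounded_box[B6 [d6 [d60 h6]]]].
pose B := Num.max B1 (Num.max B2 (Num.max B3 (Num.max B4 (Num.max B5 B6)))).
pose d := Num.min d1 (Num.min d2 (Num.min d3 (Num.min d4 (Num.min d5 d6)))).
exists B, d; split; first by rewrite !lt_min d10 d20 d30 d40 d50.
move=> q; rewrite /box /= !lt_min => /and5P[q1 q2 q3 q4 /andP[q5 q6]].
by rewrite /B !le_max h1 // h2 // h3 // h4 // h5 // h6 // !orbT.
Qed.

Lemma smooth_bounded2 D f p : smooth D f -> D p -> exists B d, 0 < d /\
  forall q, box p d q -> [/\ N (pd1 f q) <= B, N (pd2 f q) <= B &
    [/\ N (pd1 (pd1 f) q) <= B, N (pd2 (pd1 f) q) <= B,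
        N (pd1 (pd2 f) q) <= B & N (pd2 (pd2 f) q) <= B]].
Proof.
move=> sf Dp; have s1 := smooth_pd1 sf; have s2 := smooth_pd2 sf.
have c g : smooth D g -> {for p, continuous g} by move=> sg; exact: smooth_continuous sg Dp.
apply: bounded_box6.
  by split; [exact: c s1 | exact: c s2 | exact: c (smooth_pd1 s1)].
by split; [exact: c (smooth_pd2 s1) | exact: c (smooth_pd1 s2) | exact: c (smooth_pd2 s2)].
Qed.

(** Between [p] and a point [s] of the segment the gradient changes by at most [2 * B * nm (s - p)],
    and the mean value inequality doubles once more, whence the constant 4. *)
Lemma taylor2 (W W1 W2 W11 W12 W21 W22 : pt F -> F) c r (B : R) p q : 0 <= B ->
  (forall s, box c r s -> [/\ hasd W s (W1 s) (W2 s), hasd W1 s (W11 s) (W12 s) &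
     hasd W2 s (W21 s) (W22 s)]) ->
  (forall s, box c r s -> [/\ N (W11 s) <= B, N (W12 s) <= B, N (W21 s) <= B & N (W22 s) <= B]) ->
  box c r p -> box c r q ->
  N (W q - W p - lin2 (W1 p) (W2 p) (q - p)) <= 4 * B * nm (q - p) ^+ 2.
Proof.
move=> B0 hW hB bp bq.
have n0 := nm_ge0 M (q - p).
have -> : 4 * B * nm (q - p) ^+ 2 = 2 * (2 * B * nm (q - p)) * nm (q - p) by ring.
apply: (mean_value (P := W1) (Q := W2)) => t ht s.
have bs : box c r s by exact: box_segment.
have [h1 h2 h3] := hW s bs.
have sp : nm (s - p) <= nm (q - p).
  have -> : s - p = em t *: (q - p) by rewrite /s addrAC subrr add0r.
  by rewrite nmZ mdl_emb ger0_norm; [apply: ler_piMl => // |]; lra.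
have K : 2 * B * nm (s - p) <= 2 * B * nm (q - p).
  by apply: ler_wpM2l => //; rewrite mulr_ge0.
have z (x y : F) : x - y = x - y - lin2 0 0 (s - p) by rewrite /lin2 !mul0r; ring.
split=> //; apply: le_trans K; rewrite z.
  by apply: mean_value_box bp bs => u bu; have [? ? ?] := hW u bu; have [? ? ? ?] := hB u bu;
    rewrite !subr0; split; eassumption.
by apply: mean_value_box bp bs => u bu; have [? ? ?] := hW u bu; have [? ? ? ?] := hB u bu;
    rewrite !subr0; split; eassumption.
Qed.

Definition subdivision p0 n p (j : nat) : pt F := p0 + em (j%:R / n.+1%:R) *: (p - p0).

(* For a closed form [P dx + Q dy] the partial derivatives of its Riemann sum along
   the segment from [p0] to [p] are sums of this shape, with [W := P] and [W := Q];
   they approach [W p] because [W p] telescopes as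
   [\sum_(j < n.+1) ((j + 1) / (n + 1) * W x_(j+1) - j / (n + 1) * W x_j)]. *)
Lemma euler_sum (W W1 W2 W11 W12 W21 W22 : pt F -> F) p0 r (B : R) p n :
  0 < r <= 1 -> 0 <= B ->
  (forall s, box p0 r s -> [/\ hasd W s (W1 s) (W2 s), hasd W1 s (W11 s) (W12 s) &
     hasd W2 s (W21 s) (W22 s)]) ->
  (forall s, box p0 r s -> N (W1 s) <= B /\ N (W2 s) <= B) ->
  (forall s, box p0 r s -> [/\ N (W11 s) <= B, N (W12 s) <= B, N (W21 s) <= B & N (W22 s) <= B]) ->
  box p0 r p ->
  N (\sum_(j < n.+1) em (n.+1%:R^-1) * (W (subdivision p0 n p j) +
       em (j%:R / n.+1%:R) * lin2 (W1 (subdivision p0 n p j)) (W2 (subdivision p0 n p j)) (p - p0)) - W p)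
    <= 6 * B / n.+1%:R.
Proof.
move=> hr B0 hW hB1 hB2 bp; pose x := subdivision p0 n p; rewrite -/x.
have n0 : 0 < n.+1%:R :> R by rewrite ltr0Sn.
pose c (j : nat) : R := j%:R / n.+1%:R.
have c01 j : (j <= n.+1)%N -> 0 <= c j <= 1.
  by move=> jn; rewrite /c divr_ge0 // ler_pdivrMr // mul1r ler_nat.
have bx j : (j <= n.+1)%N -> box p0 r (x j).
  by move=> jn; apply: box_segment => //; [apply: box_center; lra | exact: c01].
have xn : x n.+1 = p by rewrite /x /subdivision divff ?gt_eqF // rmorph1 scale1r addrC subrK.
have cS j : c j.+1 = c j + n.+1%:R^-1 by rewrite /c -natr1 mulrDl mul1r.
have xS j : x j.+1 - x j = em n.+1%:R^-1 *: (p - p0).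
  by rewrite /x /subdivision opprD addrACA subrr add0r -scalerBl -rmorphB -/(c _) -/(c _) cS addrC addKr.
have -> : W p = \sum_(j < n.+1) (em (c j.+1) * W (x j.+1) - em (c j) * W (x j)).
  rewrite -(big_mkord xpredT (fun j => em (c j.+1) * W (x j.+1) - em (c j) * W (x j))).
  rewrite telescope_sumr // xn /c divff ?gt_eqF // mul0r rmorph1 rmorph0; ring.
rewrite -sumrB; apply: le_trans (mdl_sum _ _) _.
have -> : 6 * B / n.+1%:R = \sum_(j < n.+1) 6 * B / n.+1%:R ^+ 2.
  by rewrite sumr_const card_ord -mulr_natl; field; rewrite gt_eqF.
apply: ler_sum => j _; have jn : (j <= n.+1)%N by apply: ltnW.
have jn' : (j.+1 <= n.+1)%N by [].
have bj := bx j jn; have bj' := bx j.+1 jn'.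
rewrite cS rmorphD -/(c j).
set y := em n.+1%:R^-1.
(* Against the telescoping difference, a summand errs by [em (c j)] times a second-order Taylor
   remainder plus [y] times an increment of [W]. These cost [4 * B] and [2 * B] times
   [n.+1%:R ^- 2], and there are [n.+1] summands: hence the 6. *)
have -> : y * (W (x j) + em (c j) * lin2 (W1 (x j)) (W2 (x j)) (p - p0)) -
   ((em (c j) + y) * W (x j.+1) - em (c j) * W (x j)) =
   - (em (c j) * (W (x j.+1) - W (x j) - lin2 (W1 (x j)) (W2 (x j)) (x j.+1 - x j))
    + y * (W (x j.+1) - W (x j) - lin2 0 0 (x j.+1 - x j))).
  by rewrite xS -/y /lin2 !ptE; ring.
rewrite mdlN; apply: le_trans (mdlD _ _ _) _; rewrite !mdlM !mdl_emb.
have [cj0 cj1] : 0 <= c j /\ c j <= 1 by have := c01 j jn => /andP.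
rewrite (ger0_norm cj0) ger0_norm ?invr_ge0 ?(ltW n0) //.
have i1 := taylor2 B0 hW hB2 bj bj'.
have i2 : N (W (x j.+1) - W (x j) - lin2 0 0 (x j.+1 - x j)) <= 2 * B * nm (x j.+1 - x j).
  apply: mean_value_box bj bj' => u bu; have [? _ _] := hW u bu; have [? ?] := hB1 u bu.
  by rewrite !subr0; split; eassumption.
(* The bound [r <= 1] is what makes a mesh step no longer than [n.+1%:R^-1]. *)
have i3 : nm (x j.+1 - x j) <= n.+1%:R^-1.
  rewrite xS nmZ mdl_emb ger0_norm ?invr_ge0 ?(ltW n0) //.
  by rewrite ler_piMr ?invr_ge0 ?(ltW n0) //; move: bp; rewrite /box /=; lra.
have n1 : 0 <= n.+1%:R^-1 :> R by rewrite invr_ge0 ltW.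
have m0 := nm_ge0 M (x j.+1 - x j).
have -> : 6 * B / n.+1%:R ^+ 2 = 4 * B * n.+1%:R^-1 ^+ 2 + n.+1%:R^-1 * (2 * B * n.+1%:R^-1) :> R.
  by field; rewrite gt_eqF.
apply: lerD.
  apply: le_trans (ler_piMl (mdl_ge0 _ _) cj1) _; apply: le_trans i1 _.
  by apply: ler_wpM2l; [rewrite mulr_ge0 | rewrite lerXn2r].
apply: ler_wpM2l => //; apply: le_trans i2 _; apply: ler_wpM2l => //.
by rewrite mulr_ge0.
Qed.

(** [E n] is the left Riemann sum of the form along the segment from [p0]. Its first partial
    derivative contains [pd1 Q], which closedness replaces by [pd2 P], and symmetrically for the
    second; the results are the sums [S P n] and [S Q n], which [euler_sum] compares with [P] and
    [Q]. *)
Lemma poincare D (P Q : pt F -> F) p0 : open D -> D p0 -> smooth D P -> smooth D Q ->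
  (forall p, D p -> pd1 Q p = pd2 P p) ->
  exists r f, [/\ 0 < r, box p0 r `<=` D, f p0 = 0 &
    forall p, box p0 r p -> hasd f p (P p) (Q p)].
Proof.
move=> oD Dp0 sP sQ closed.
have [B1 [d1 [d10 h1]]] := smooth_bounded2 sP Dp0.
have [B2 [d2 [d20 h2]]] := smooth_bounded2 sQ Dp0.
have [d3 d30 h3] := open_boxP M oD Dp0.
pose B := Num.max B1 B2.
pose r := Num.min 1 (Num.min d1 (Num.min d2 d3)).
have r0 : 0 < r by rewrite !lt_min ltr01 d10 d20.
have r1 : r <= 1 by rewrite ge_min lexx.
have br q : box p0 r q -> [/\ box p0 d1 q, box p0 d2 q & D q].
  by rewrite /box /= !lt_min => /and4P[_ ? ? ?]; split=> //; exact: h3.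
have B0 : 0 <= B.
  have [b1 _ _] := br p0 (box_center M p0 r0); have [b _ _] := h1 p0 b1.
  by rewrite le_max (le_trans (mdl_ge0 _ _) b).
have LB x : x <= B1 -> x <= B by rewrite le_max => ->.
have LB' x : x <= B2 -> x <= B by rewrite le_max orbC => ->.
have hd f s : smooth D f -> box p0 r s -> [/\ hasd f s (pd1 f s) (pd2 f s),
    hasd (pd1 f) s (pd1 (pd1 f) s) (pd2 (pd1 f) s) &
    hasd (pd2 f) s (pd1 (pd2 f) s) (pd2 (pd2 f) s)].
  move=> sf /br[_ _ Ds]; split; first exact: (smooth_hasd sf Ds).
    exact: (smooth_hasd (smooth_pd1 sf) Ds).
  exact: (smooth_hasd (smooth_pd2 sf) Ds).
pose x n (j : nat) p := subdivision p0 n p j.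
have bx n (j : 'I_n.+1) p : box p0 r p -> box p0 r (x n j p).
  move=> bp; apply: box_segment => //; first exact: box_center.
  by rewrite divr_ge0 // ler_pdivrMr ?ltr0Sn // mul1r ler_nat ltnW.
pose E n p := \sum_(j < n.+1) em n.+1%:R^-1 *
  (P (x n j p) * (p.1 - p0.1) + Q (x n j p) * (p.2 - p0.2)).
pose S (W : pt F -> F) n p := \sum_(j < n.+1) em n.+1%:R^-1 * (W (x n j p) +
  em (j%:R / n.+1%:R) * lin2 (pd1 W (x n j p)) (pd2 W (x n j p)) (p - p0)).
have hE n s : box p0 r s -> hasd (E n) s (S P n s) (S Q n s).
  move=> bs; apply: hasd_sum => j; have bj := bx n j s bs; have [_ _ Dj] := br _ bj.
  set c := em (j%:R / n.+1%:R); set y := em _.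
  have h0 (a : F) (g : pt F -> F) (A A' : F) : hasd g s A A' -> hasd (fun q => a + c * (g q - a)) s (c * A) (c * A').
    move=> hg; have := hasdD (hasd_cst a s) (hasdM (hasd_cst c s) (hasdB hg (hasd_cst a s))).
    by apply: hasd_ext => //; ring.
  have hx (W : pt F -> F) : smooth D W ->
      hasd (fun q => W (x n j q)) s (c * pd1 W (x n j s)) (c * pd2 W (x n j s)).
    move=> sW; have := hasd_comp (g1 := fun q => p0.1 + c * (q.1 - p0.1))
      (g2 := fun q => p0.2 + c * (q.2 - p0.2)) _ (h0 p0.1 _ _ _ (hasd_fst M s)) (h0 p0.2 _ _ _ (hasd_snd M s)).
    move=> /(_ _ _ _ (smooth_hasd sW Dj)).
    by apply: hasd_ext => //; ring.
  have hP := hasdM (hx P sP) (hasdB (hasd_fst M s) (hasd_cst p0.1 s)).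
  have hQ := hasdM (hx Q sQ) (hasdB (hasd_snd M s) (hasd_cst p0.2 s)).
  have := hasdM (hasd_cst y s) (hasdD hP hQ); apply: hasd_ext => //.
    by rewrite (closed _ Dj) /lin2 !ptE; ring.
  by rewrite -(closed _ Dj) /lin2 !ptE; ring.
have [||| f [f0 hf]] := @uniform_primitive _ _ M p0 r E (S P) (S Q) P Q (6 * B) r0.
- by move=> n; rewrite /E big1 // => j _; rewrite !subrr !mulr0 addr0 mulr0.
- move=> n s bs; split; first exact: hE.
    apply: euler_sum bs => //; [by rewrite r0 | by move=> u; exact: hd | |] => u /br[/h1[? ? [? ? ? ?]] _ _];
    by split; exact: LB.
  apply: euler_sum bs => //; [by rewrite r0 | by move=> u; exact: hd | |] => u /br[_ /h2[? ? [? ? ? ?]] _];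
  by split; exact: LB'.
- by move=> s /br[_ _ Ds]; split; [exact: smooth_continuous sP Ds | exact: smooth_continuous sQ Ds].
by exists r, f; split=> // s /br[].
Qed.

End Poincare.

Section IntegratingFactor.
Variables (R : realType) (F : numFieldType) (M : modulus R F).
Local Notation N := (mdl M).
Local Notation nm := (nm M).
Local Notation box := (box M).
Implicit Types (p q y : pt F) (f : pt F -> F) (D U V : set (pt F)).

Lemma hasd_unique f p (A B A' B' : F) : hasd f p A B -> hasd f p A' B' -> A = A' /\ B = B'.
Proof. by move=> /hasd_diff[_ <- <-] /hasd_diff[_ <- <-]. Qed.

Lemma pt0E : (0 : pt F) = (0, 0). Proof. by []. Qed.

(* The logarithm is a primitive of [1 / (1 + x)]; the inverse of the map
   [(x, y) -> (log (1 + x), y)] gives the exponential near [0]. *)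
Lemma local_exp : exists d (e : pt F -> F), [/\ 0 < d, smooth (box 0 d) e &
  forall y, box 0 d y -> e y != 0 /\ hasd e y (e y) 0].
Proof.
pose D : set (pt F) := [set p | 1 + p.1 != 0].
have cD p : {for p, continuous (fun q : pt F => 1 + q.1)}.
  exact: (hasd_continuous (hasdD (hasd_cst 1 p) (hasd_fst M p))).
have oD : open D.
  rewrite openE => p Dp; have [r r0 h] := continuous_neq0 M (cD p) Dp.
  by apply/(nbhs_boxP M); exists r.
have D0 : D 0 by rewrite /D /= addr0 oner_neq0.
pose P (p : pt F) : F := (1 + p.1)^-1; pose Q (p : pt F) : F := 0.
have sP : smooth D P.
  have s1 := smooth_cst M 1 oD; have s2 := smoothD M oD s1 (smooth_fst M oD).
  have nz p : D p -> 1 + p.1 != 0 by [].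
  by apply: (smooth_ext M oD _ (smoothF M oD nz s1 s2)) => p _; rewrite div1r.
have sQ : smooth D Q := smooth_cst M 0 oD.
have hP p : D p -> hasd P p (- 1 / (1 + p.1) ^+ 2) 0.
  move=> Dp; have := hasdV (hasdD (hasd_cst 1 p) (hasd_fst M p)) Dp.
  by apply: hasd_ext => //; rewrite ?add0r ?oppr0 ?mul0r.
have closed p : D p -> pd1 Q p = pd2 P p.
  move=> Dp; have [_ _ ->] := hasd_diff (hP p Dp).
  by have [_ -> _] := hasd_diff (hasd_cst 0 p : hasd Q p 0 0).
have [r [L [r0 rD L0 hL]]] := poincare M oD D0 sP sQ closed.
have oB : open (box 0 r) := @open_box _ _ M 0 r.
have B0 := box_center M 0 r0.
have sL : smooth (box 0 r) L.
  exact (smooth_step M oB hL (smooth_sub rD sP) (smooth_sub rD sQ)).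
have jL : jac L snd 0 != 0.
  have [_ a1 a2] := hasd_diff (hL _ B0); have [_ b1 b2] := hasd_diff (hasd_snd M 0).
  by rewrite /jac a1 a2 b1 b2 /P /Q addr0 invr1 mulr1 mul0r subr0 oner_neq0.
have [d [U [s1 [s2 [d0 _ UB ch]]]]] := inverse_function_theorem M oB B0 sL (smooth_snd M oB) jL.
rewrite L0 -pt0E in ch.
exists d, (fun y => 1 + s1 y); split=> //.
  have oV : open (box 0 d) := @open_box _ _ M 0 d.
  exact (smoothD M oV (smooth_cst M 1 oV) (chart_bwd1 ch)).
move=> y Vy; have Uy := chart_from ch Vy; have Dy := rD _ (UB _ Uy); split=> //.
have h1 := smooth_hasd (chart_bwd1 ch) Vy; have h2 := smooth_hasd (chart_bwd2 ch) Vy.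
have hc := hasd_comp (hL _ (UB _ Uy)) h1 h2.
have hf : hasd fst y (P (s1 y, s2 y) * pd1 s1 y + Q (s1 y, s2 y) * pd1 s2 y)
                     (P (s1 y, s2 y) * pd2 s1 y + Q (s1 y, s2 y) * pd2 s2 y).
  apply: (hasd_near M (@open_box _ _ M 0 d) Vy _ hc) => z Vz.
  by have := chart_fromK ch Vz => /(congr1 fst).
(* Differentiating the identity [L (s1, s2) = fst] gives [(1 + s1)^-1] times the gradient of [s1]
   equal to [(1, 0)], which is the differential equation of the exponential for [1 + s1]. *)
have [e1 e2] := hasd_unique hf (hasd_fst M y).
have Dy' : 1 + s1 y != 0 := Dy.
have := hasdD (hasd_cst 1 y) h1; apply: hasd_ext => //.
  move: e1; rewrite /P /Q /= mul0r addr0 add0r => e1.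
  by rewrite -[pd1 s1 y](mulKf (_ : (1 + s1 y)^-1 != 0)) ?invr_eq0 // e1 invrK mulr1.
move: e2; rewrite /P /Q /= mul0r addr0 add0r => /eqP.
by rewrite mulf_eq0 invr_eq0 (negbTE Dy') /= => /eqP.
Qed.

(** [f] is the exponential of a primitive [h] of the form. As [h] vanishes at [p0], a small box is
    mapped by [h] into the region where [local_exp] is available; the second argument 0 is a dummy,
    the exponential having been built as a function on the plane. *)
Lemma integrating_factor D (P Q : pt F -> F) p0 : open D -> D p0 -> smooth D P -> smooth D Q ->
  (forall p, D p -> pd1 Q p = pd2 P p) ->
  exists r f, [/\ 0 < r, box p0 r `<=` D, smooth (box p0 r) f &
    forall p, box p0 r p -> f p != 0 /\ hasd f p (f p * P p) (f p * Q p)].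
Proof.
move=> oD Dp0 sP sQ closed.
have [r [h [r0 rD h0 hh]]] := poincare M oD Dp0 sP sQ closed.
have [d [e [d0 se he]]] := local_exp.
have oB : open (box p0 r) := @open_box _ _ M p0 r.
have sh : smooth (box p0 r) h.
  exact (smooth_step M oB hh (smooth_sub rD sP) (smooth_sub rD sQ)).
pose U := [set p | box p0 r p /\ box 0 d (h p, 0)].
have oU : open U.
  apply: (open_preimage M oB (@open_box _ _ M 0 d)) => p bp.
    exact: smooth_continuous sh bp.
  exact: hasd_continuous (hasd_cst 0 p).
have U0 : U p0 by split; [exact: box_center | rewrite h0 -pt0E; exact: box_center].
have [s s0 sU] := open_boxP M oU U0.
have sr : box p0 s `<=` box p0 r by move=> p /sU[].
exists s, (fun p => e (h p, 0)); split=> //.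
- by move=> p /sr /rD.
- have oS : open (box p0 s) := @open_box _ _ M p0 s.
  have oE : open (box 0 d) := @open_box _ _ M 0 d.
  have hE p : box p0 s p -> box 0 d (h p, 0) by move=> /sU[].
  exact (smooth_comp M oS oE hE se (smooth_sub sr sh) (smooth_cst M 0 oS)).
- move=> p /sU[bp Vp]; have [e1 e2] := he _ Vp; split=> //.
  have := hasd_comp (g2 := fun=> 0) e2 (hh p bp) (hasd_cst 0 p).
  by apply: hasd_ext => //; rewrite mulr0 addr0.
Qed.

End IntegratingFactor.

(** * Consequences of the equality of the curvature forms *)

Section WebAlgebra.
Variables (R : realType) (F : numFieldType) (M : modulus R F).
Local Notation N := (mdl M).
Local Notation nm := (nm M).
Local Notation box := (box M).
Implicit Types (p q v : pt F) (f : pt F -> F).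

(** This is [d (d f) = 0], with second derivatives given as coefficients of [hasd] so that they can
    be computed by the rules and then compared. *)
Lemma mixed_partials (D : set (pt F)) f (P Q : pt F -> F) p (P1 P2 Q1 Q2 : F) :
  open D -> D p -> smooth D P -> smooth D Q ->
  (forall q, D q -> hasd f q (P q) (Q q)) -> hasd P p P1 P2 -> hasd Q p Q1 Q2 -> Q1 = P2.
Proof.
move=> oD Dp sP sQ hf hP hQ.
have sf : smooth D f := smooth_step M oD hf sP sQ.
have e1 : hasd (pd1 f) p P1 P2.
  by apply: (hasd_near M oD Dp _ hP) => q /hf /hasd_diff[].
have e2 : hasd (pd2 f) p Q1 Q2.
  by apply: (hasd_near M oD Dp _ hQ) => q /hf /hasd_diff[].
have [_ _ <-] := hasd_diff e1; have [_ <- _] := hasd_diff e2.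
exact (schwarz M oD Dp (sf 2%N)).
Qed.

Variables (D : set (pt F)) (X : web F) (d : web_data F).
Hypotheses (oD : open D) (wd : is_web_data D X d).
Hypotheses (nc : nonconstant_invariant D d) (ec : equal_curvatures D d).
Hypothesis W0 : forall p, D p -> wedge (omega d ix1) (omega d ix2) p != 0.

Let A1 p := (omega d ix1 p).1.
Let A2 p := (omega d ix1 p).2.
Let B1 p := (omega d ix2 p).1.
Let B2 p := (omega d ix2 p).2.
Let T1 p := (theta d p).1.
Let T2 p := (theta d p).2.
Let a := binv d.
Let a1 := binv1 d.
Let a2 := binv2 d.
Let a11 := binv11 d.
Let a12 := binv12 d.
Let a22 := binv22 d.
Let K := curv d.

Definition weight_k p : F := (a p * a2 p - a1 p) / (a p * (1 - a p)).
Definition weight_c p : F := (a1 p - a2 p) / (1 - a p).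
Local Notation k := weight_k.
Local Notation c := weight_c.

Let sA1 : smooth D A1. Proof. by case: (wd_forms wd ix1) => -[]. Qed.
Let sA2 : smooth D A2. Proof. by case: (wd_forms wd ix1) => -[]. Qed.
Let sB1 : smooth D B1. Proof. by case: (wd_forms wd ix2) => -[]. Qed.
Let sB2 : smooth D B2. Proof. by case: (wd_forms wd ix2) => -[]. Qed.
Let sT1 : smooth D T1. Proof. by case: (wd_theta_smooth wd). Qed.
Let sT2 : smooth D T2. Proof. by case: (wd_theta_smooth wd). Qed.
Let sa : smooth D a. Proof. exact: wd_a_smooth wd. Qed.
Let sa1 : smooth D a1. Proof. by case: (wd_a_cov1 wd). Qed.
Let sa2 : smooth D a2. Proof. by case: (wd_a_cov1 wd). Qed.

Let a0 p : D p -> a p != 0. Proof. by move=> /(wd_a_neq wd)[]. Qed.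
Let a1m p : D p -> 1 - a p != 0.
Proof. by move=> /(wd_a_neq wd)[_]; rewrite subr_eq0 eq_sym. Qed.

Let dw1 p : D p -> pd1 A2 p = pd2 A1 p + (A1 p * T2 p - A2 p * T1 p).
Proof.
move=> Dp; have := wd_theta wd (c := ix1) isT Dp; rewrite /dform /wedge => h.
by rewrite -[RHS]/(pd2 A1 p + ((omega d ix1 p).1 * (theta d p).2 - (omega d ix1 p).2 * (theta d p).1)) -h addrC subrK.
Qed.

Let dw2 p : D p -> pd1 B2 p = pd2 B1 p + (B1 p * T2 p - B2 p * T1 p).
Proof.
move=> Dp; have := wd_theta wd (c := ix2) isT Dp; rewrite /dform /wedge => h.
by rewrite -[RHS]/(pd2 B1 p + ((omega d ix2 p).1 * (theta d p).2 - (omega d ix2 p).2 * (theta d p).1)) -h addrC subrK.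
Qed.

Let dth p : D p -> pd1 T2 p = pd2 T1 p + K p * (A1 p * B2 p - A2 p * B1 p).
Proof.
move=> Dp; have := wd_K wd Dp; rewrite /dform /wedge => h.
by rewrite -[RHS]/(pd2 T1 p + curv d p * ((omega d ix1 p).1 * (omega d ix2 p).2 - (omega d ix1 p).2 * (omega d ix2 p).1)) -h addrC subrK.
Qed.

Let hA1 p : D p -> hasd A1 p (pd1 A1 p) (pd2 A1 p). Proof. exact: smooth_hasd. Qed.
Let hA2 p : D p -> hasd A2 p (pd1 A2 p) (pd2 A2 p). Proof. exact: smooth_hasd. Qed.
Let hB1 p : D p -> hasd B1 p (pd1 B1 p) (pd2 B1 p). Proof. exact: smooth_hasd. Qed.
Let hB2 p : D p -> hasd B2 p (pd1 B2 p) (pd2 B2 p). Proof. exact: smooth_hasd. Qed.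
Let hT1 p : D p -> hasd T1 p (pd1 T1 p) (pd2 T1 p). Proof. exact: smooth_hasd. Qed.
Let hT2 p : D p -> hasd T2 p (pd1 T2 p) (pd2 T2 p). Proof. exact: smooth_hasd. Qed.

Let ha p : D p -> hasd a p (a1 p * A1 p + a2 p * B1 p) (a1 p * A2 p + a2 p * B2 p).
Proof.
move=> Dp; have [_ _ /(_ p Dp) h] := wd_a_cov1 wd.
have := smooth_hasd sa Dp; apply: hasd_ext => //.
  by have := congr1 fst h; apply.
by have := congr1 snd h; apply.
Qed.

Let ha1 p : D p -> hasd a1 p (a1 p * T1 p + (a11 p * A1 p + a12 p * B1 p))
                            (a1 p * T2 p + (a11 p * A2 p + a12 p * B2 p)).
Proof.
move=> Dp; have h := wd_a1_cov wd Dp.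
have := smooth_hasd sa1 Dp; apply: hasd_ext => //.
  by have := congr1 fst h => /= h1; apply/eqP; rewrite addrC -subr_eq; apply/eqP.
by have := congr1 snd h => /= h1; apply/eqP; rewrite addrC -subr_eq; apply/eqP.
Qed.

Let ha2 p : D p -> hasd a2 p (a2 p * T1 p + (a12 p * A1 p + a22 p * B1 p))
                            (a2 p * T2 p + (a12 p * A2 p + a22 p * B2 p)).
Proof.
move=> Dp; have h := wd_a2_cov wd Dp.
have := smooth_hasd sa2 Dp; apply: hasd_ext => //.
  by have := congr1 fst h => /= h1; apply/eqP; rewrite addrC -subr_eq; apply/eqP.
by have := congr1 snd h => /= h1; apply/eqP; rewrite addrC -subr_eq; apply/eqP.
Qed.

(** The nonzero factor [omega_1 /\ omega_2] and the curvature cancel from the three equalities. What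
    remains is triangular: the subweb [1,2,4] determines [a12], after which [1,3,4] gives [a22] and
    [2,3,4] gives [a11]. *)
Lemma second_derivatives p : D p ->
  [/\ a12 p = a1 p * a2 p / a p,
      a22 p = a1 p * a2 p / a p + a2 p * (a1 p - a2 p) / (1 - a p) &
      a11 p = a1 p * a2 p / a p
        - (2 * a p - 1) * a1 p * (a1 p - a2 p) / (a p * (1 - a p))].
Proof.
move=> Dp; have [] := ec Dp; rewrite /Theta123 /Theta124 /Theta134 /Theta234.
have Wp := W0 Dp; have ap := a0 Dp; have am := a1m Dp.
move=> /(mulIf Wp); rewrite -/a -/a1 -/a2 -/a12 -/a11 -/a22 -/K => e1.
move=> /(mulIf Wp); rewrite -/a -/a1 -/a2 -/a12 -/a11 -/a22 -/K => e2.
move=> /(mulIf Wp); rewrite -/a -/a1 -/a2 -/a12 -/a11 -/a22 -/K => e3.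
have i1 : a12 p = a1 p * a2 p / a p.
  have -> : a12 p = a p * (K p - (K p - a12 p / a p + a1 p * a2 p / a p ^+ 2))
     + a1 p * a2 p / a p by field.
  by rewrite -e1 subrr mulr0 add0r.
have i2 : a22 p = a12 p + a2 p * (a1 p - a2 p) / (1 - a p).
  have -> : a22 p = (1 - a p) * (K p - (K p + a2 p * (a1 p - a2 p) / (1 - a p) ^+ 2
      + (a12 p - a22 p) / (1 - a p))) + (a12 p + a2 p * (a1 p - a2 p) / (1 - a p)) by field.
  by rewrite -e2 subrr mulr0 add0r.
have i3 : a11 p = a12 p - (2 * a p - 1) * a1 p * (a1 p - a2 p) / (a p * (1 - a p)).
  have -> : a11 p = - (a p * (1 - a p)) * (K p - (K p +
      (2 * a p - 1) * a1 p * (a1 p - a2 p) / (a p ^+ 2 * (1 - a p) ^+ 2)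
      + (a11 p - a12 p) / (a p * (1 - a p)))) + (a12 p
      - (2 * a p - 1) * a1 p * (a1 p - a2 p) / (a p * (1 - a p))) by field; rewrite ap am.
  by rewrite -e3 subrr mulr0 add0r.
by split=> //; rewrite ?i2 ?i3 i1.
Qed.

Lemma hasd_weight_k p : D p -> hasd k p (k p * T1 p) (k p * T2 p).
Proof.
move=> Dp; have ap := a0 Dp; have am := a1m Dp.
have [e12 e22 e11] := second_derivatives Dp.
have dn : a p * (1 - a p) != 0 by rewrite mulf_neq0.
have := hasdF (hasdB (hasdM (ha Dp) (ha2 Dp)) (ha1 Dp))
  (hasdM (ha Dp) (hasdB (hasd_cst 1 p) (ha Dp))) dn.
by apply: hasd_ext => //; rewrite /weight_k e12 e22 e11; field; rewrite ap am.
Qed.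

Lemma hasd_weight_c p : D p ->
  hasd c p (c p * T1 p - c p * (k p + c p) * A1 p) (c p * T2 p - c p * (k p + c p) * A2 p).
Proof.
move=> Dp; have ap := a0 Dp; have am := a1m Dp.
have [e12 e22 e11] := second_derivatives Dp.
have := hasdF (hasdB (ha1 Dp) (ha2 Dp)) (hasdB (hasd_cst 1 p) (ha Dp)) am.
by apply: hasd_ext => //; rewrite /weight_c /weight_k e12 e22 e11; field; rewrite ap am.
Qed.

Lemma smooth_weight_k : smooth D k.
Proof.
apply: (smoothF M oD); first by move=> p Dp; rewrite mulf_neq0 // (a0 Dp, a1m Dp).
  exact (smoothB M oD (smoothM M oD sa sa2) sa1).
exact (smoothM M oD sa (smoothB M oD (smooth_cst M 1 oD) sa)).
Qed.

Lemma smooth_weight_c : smooth D c.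
Proof.
apply: (smoothF M oD); first by move=> p Dp; rewrite (a1m Dp).
  exact (smoothB M oD sa1 sa2).
exact (smoothB M oD (smooth_cst M 1 oD) sa).
Qed.

Lemma curvature_eq0 p : D p -> K p = 0.
Proof.
move=> Dp; have Wp : A1 p * B2 p - A2 p * B1 p != 0 := W0 Dp.
have sk := smooth_weight_k; have sc := smooth_weight_c.
have hk := hasd_weight_k; have hc := hasd_weight_c.
(* In [d (k theta) = 0] the part [dk /\ theta] is [k theta /\ theta = 0], so only [k] times
   [d theta] is left. *)
have kK : k p * K p = 0.
  have := mixed_partials oD Dp (smoothM M oD sk sT1) (smoothM M oD sk sT2) hk
    (hasdM (hk p Dp) (hT1 Dp)) (hasdM (hk p Dp) (hT2 Dp)).
  rewrite (dth Dp) => /eqP; rewrite -subr_eq0 => /eqP h.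
  apply: (mulIf Wp); rewrite mul0r -[RHS]h; ring.
(* In the second differential of [c] the multiples of [omega_1 /\ theta], among them the one from
   [d omega_1], cancel, and again only [c] times [d theta] is left. *)
have cK : c p * K p = 0.
  have sP (T A : pt F -> F) : smooth D T -> smooth D A ->
      smooth D (fun p => c p * T p - c p * (k p + c p) * A p).
    move=> sT sA; exact (smoothB M oD (smoothM M oD sc sT)
      (smoothM M oD (smoothM M oD sc (smoothD M oD sk sc)) sA)).
  have hP T A t1 t2 b1 b2 : hasd T p t1 t2 -> hasd A p b1 b2 -> _ :=
    fun hT hA => hasdB (hasdM (hc p Dp) hT)
      (hasdM (hasdM (hc p Dp) (hasdD (hk p Dp) (hc p Dp))) hA).
  have := mixed_partials oD Dp (sP _ _ sT1 sA1) (sP _ _ sT2 sA2) hc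
    (hP _ _ _ _ _ _ (hT1 Dp) (hA1 Dp)) (hP _ _ _ _ _ _ (hT2 Dp) (hA2 Dp)).
  rewrite (dth Dp) (dw1 Dp) => /eqP; rewrite -subr_eq0 => /eqP h.
  apply: (mulIf Wp); rewrite mul0r -[RHS]h; ring.
case: (eqVneq (K p) 0) => // K0; case: (nc Dp); rewrite -/a1 -/a2.
move: kK cK => /eqP; rewrite mulf_eq0 (negbTE K0) orbF => /eqP k0.
move=> /eqP; rewrite mulf_eq0 (negbTE K0) orbF => /eqP c0.
have ap := a0 Dp; have am := a1m Dp.
(* The definitions of [k] and [c] are linear in [a1], [a2] and can be inverted. *)
have e1 : a1 p = - (a p * (k p + c p)) by rewrite /weight_k /weight_c; field; rewrite ap am.
have e2 : a2 p = - (a p * k p + c p) by rewrite /weight_k /weight_c; field; rewrite ap am.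
by rewrite e1 e2 k0 c0 !addr0 mulr0 oppr0.
Qed.

(** The equation is [df /\ w = 0]: [f] is infinitesimally constant on the curves [w = 0], and its
    differential is allowed to vanish, as it does for the constant coefficients used below. *)
Definition along (U : set (pt F)) (w : form1 F) f : Prop :=
  forall p, U p -> exists P Q, hasd f p P Q /\ P * (w p).2 = Q * (w p).1.

(* A leaf on which [al], [be] and [al * u + be * v] are constant is mapped by [(u, v)]
   into the line [al * x + be * y = const]. *)
Lemma linear_coordinates p0 : D p0 -> exists r (u v : pt F -> F),
  [/\ 0 < r, box p0 r `<=` D, smooth (box p0 r) u & smooth (box p0 r) v] /\
  (forall p, box p0 r p -> jac u v p != 0) /\
  (forall i : 'I_4, exists al be : pt F -> F,
    [/\ forall p, box p0 r p -> (al p != 0) || (be p != 0),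
        along (box p0 r) (omega d i) al, along (box p0 r) (omega d i) be &
        along (box p0 r) (omega d i) (fun p => al p * u p + be p * v p)]).
Proof.
move=> Dp0; have sk := smooth_weight_k.
(* The contributions of [dk = k theta] and of [d omega_1] cancel, leaving [d theta], which is zero
   because the curvature is. *)
have c1 p : D p -> pd1 (fun p => T2 p - k p * A2 p) p = pd2 (fun p => T1 p - k p * A1 p) p.
  move=> Dp; have [_ -> _] := hasd_diff (hasdB (hT2 Dp) (hasdM (hasd_weight_k Dp) (hA2 Dp))).
  have [_ _ ->] := hasd_diff (hasdB (hT1 Dp) (hasdM (hasd_weight_k Dp) (hA1 Dp))).
  by rewrite (dth Dp) (dw1 Dp) (curvature_eq0 Dp); ring.
have c2 p : D p -> pd1 (fun p => T2 p + k p * B2 p) p = pd2 (fun p => T1 p + k p * B1 p) p.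
  move=> Dp; have [_ -> _] := hasd_diff (hasdD (hT2 Dp) (hasdM (hasd_weight_k Dp) (hB2 Dp))).
  have [_ _ ->] := hasd_diff (hasdD (hT1 Dp) (hasdM (hasd_weight_k Dp) (hB1 Dp))).
  by rewrite (dth Dp) (dw2 Dp) (curvature_eq0 Dp); ring.
have [r1 [la [r10 rD1 sla hla]]] := integrating_factor M oD Dp0
  (smoothB M oD sT1 (smoothM M oD sk sA1)) (smoothB M oD sT2 (smoothM M oD sk sA2)) c1.
have [r2 [mu [r20 rD2 smu hmu]]] := integrating_factor M oD Dp0
  (smoothD M oD sT1 (smoothM M oD sk sB1)) (smoothD M oD sT2 (smoothM M oD sk sB2)) c2.
pose r3 := Num.min r1 r2.
have r30 : 0 < r3 by rewrite lt_min r10.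
have rr1 : box p0 r3 `<=` box p0 r1 by apply: sub_box; rewrite ge_min lexx.
have rr2 : box p0 r3 `<=` box p0 r2 by apply: sub_box; rewrite ge_min lexx orbT.
have rD : box p0 r3 `<=` D by move=> p /rr1 /rD1.
have o3 : open (box p0 r3) := @open_box _ _ M p0 r3.
have b3 := box_center M p0 r30.
have {sla}sla := smooth_sub rr1 sla; have {smu}smu := smooth_sub rr2 smu.
have {}hla := fun p (bp : box p0 r3 p) => hla p (rr1 p bp).
have {}hmu := fun p (bp : box p0 r3 p) => hmu p (rr2 p bp).
(* With [d la = la (theta - k omega_1)], the term [k omega_1] drops out against [omega_1] and the
   [theta] terms cancel by the structure equation. *)
have c3 p : box p0 r3 p -> pd1 (fun p => la p * A2 p) p = pd2 (fun p => la p * A1 p) p.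
  move=> bp; have Dp := rD p bp; have [_ hl] := hla p bp.
  have [_ -> _] := hasd_diff (hasdM hl (hA2 Dp)).
  have [_ _ ->] := hasd_diff (hasdM hl (hA1 Dp)).
  by rewrite (dw1 Dp); ring.
have c4 p : box p0 r3 p -> pd1 (fun p => mu p * B2 p) p = pd2 (fun p => mu p * B1 p) p.
  move=> bp; have Dp := rD p bp; have [_ hl] := hmu p bp.
  have [_ -> _] := hasd_diff (hasdM hl (hB2 Dp)).
  have [_ _ ->] := hasd_diff (hasdM hl (hB1 Dp)).
  by rewrite (dw2 Dp); ring.
have su1 := smoothM M o3 sla (smooth_sub rD sA1).
have su2 := smoothM M o3 sla (smooth_sub rD sA2).
have sv1 := smoothM M o3 smu (smooth_sub rD sB1).
have sv2 := smoothM M o3 smu (smooth_sub rD sB2).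
have [r4 [u [r40 rD4 _ hu]]] := poincare M o3 b3 su1 su2 c3.
have [r5 [v [r50 rD5 _ hv]]] := poincare M o3 b3 sv1 sv2 c4.
pose r := Num.min r4 r5.
have r0 : 0 < r by rewrite lt_min r40.
have rr4 : box p0 r `<=` box p0 r4 by apply: sub_box; rewrite ge_min lexx.
have rr5 : box p0 r `<=` box p0 r5 by apply: sub_box; rewrite ge_min lexx orbT.
have rr3 : box p0 r `<=` box p0 r3 by move=> p /rr4 /rD4.
have o : open (box p0 r) := @open_box _ _ M p0 r.
have {}hu := fun p (bp : box p0 r p) => hu p (rr4 p bp).
have {}hv := fun p (bp : box p0 r p) => hv p (rr5 p bp).
exists r, u, v; split.
  split=> //; first by move=> p /rr3 /rD.
    exact (smooth_step M o hu (smooth_sub rr3 su1) (smooth_sub rr3 su2)).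
  exact (smooth_step M o hv (smooth_sub rr3 sv1) (smooth_sub rr3 sv2)).
split.
  (* The Jacobian is the coefficient of [du /\ dv = la mu omega_1 /\ omega_2]. *)
  move=> p bp; rewrite /jac; have [_ -> ->] := hasd_diff (hu p bp).
  have [_ -> ->] := hasd_diff (hv p bp).
  have [l0 _] := hla p (rr3 p bp); have [m0 _] := hmu p (rr3 p bp).
  have Wp : A1 p * B2 p - A2 p * B1 p != 0 := W0 (rD p (rr3 p bp)).
  have -> : la p * A1 p * (mu p * B2 p) - la p * A2 p * (mu p * B1 p) =
    la p * mu p * (A1 p * B2 p - A2 p * B1 p) by ring.
  by rewrite !mulf_neq0.
have cst (e : F) w : along (box p0 r) w (fun=> e).
  by move=> p _; exists 0, 0; rewrite !mul0r; split=> //; exact: hasd_cst.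
have w3 p : D p -> (omega d ix3 p).1 = - (A1 p + B1 p) /\ (omega d ix3 p).2 = - (A2 p + B2 p).
  move=> Dp; have h := wd_norm wd Dp; split; apply/eqP; rewrite -addr_eq0 addrC; apply/eqP.
    exact (congr1 fst h).
  exact (congr1 snd h).
have w4 p : D p -> (omega d ix4 p).1 = - (a p * A1 p + B1 p) /\
    (omega d ix4 p).2 = - (a p * A2 p + B2 p).
  move=> Dp; have h := wd_a wd Dp; split; apply/eqP; rewrite -eqr_oppLR; apply/eqP.
    exact (congr1 fst h).
  exact (congr1 snd h).
pose m p := mu p / la p.
have hm p : box p0 r p -> hasd m p (m p * k p * (A1 p + B1 p)) (m p * k p * (A2 p + B2 p)).
  move=> bp; have [l0 hl] := hla p (rr3 p bp); have [m0 hm] := hmu p (rr3 p bp).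
  by have := hasdF hm hl l0; apply: hasd_ext => //; rewrite /m; field.
have mla p : box p0 r p -> m p * la p = mu p.
  by move=> bp; have [l0 _] := hla p (rr3 p bp); rewrite /m divfK.
case=> -[|[|[|[|//]]]] hi.
- have -> : Ordinal hi = ix1 by apply: val_inj.
  exists (fun=> 1), (fun=> 0); split; [by move=> p _; rewrite oner_neq0 | exact: cst | exact: cst |].
  move=> p bp; exists (la p * A1 p), (la p * A2 p); split; last by rewrite -/(A1 p) -/(A2 p); ring.
  by apply: hasd_ext (hu p bp) => //; apply/funext => q; rewrite mul1r mul0r addr0.
- have -> : Ordinal hi = ix2 by apply: val_inj.
  exists (fun=> 0), (fun=> 1); split; [by move=> p _; rewrite oner_neq0 orbT | exact: cst | exact: cst |].
  move=> p bp; exists (mu p * B1 p), (mu p * B2 p); split; last by rewrite -/(B1 p) -/(B2 p); ring.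
  by apply: hasd_ext (hv p bp) => //; apply/funext => q; rewrite mul1r mul0r add0r.
- have -> : Ordinal hi = ix3 by apply: val_inj.
  exists m, (fun=> 1); split; [by move=> p _; rewrite oner_neq0 orbT | | exact: cst |] => p bp;
    have [e1 e2] := w3 p (rD p (rr3 p bp)); rewrite e1 e2.
    by do 2 eexists; split; [exact: hm | ring].
  (* Since [m la = mu], the differential of [m u + v] is [u dm + mu (omega_1 + omega_2)], and both
     terms are multiples of [omega_3]. *)
  do 2 eexists; split; first exact: (hasdD (hasdM (hm p bp) (hu p bp)) (hasdM (hasd_cst 1 p) (hv p bp))).
  by rewrite -(mla p bp); ring.
- have -> : Ordinal hi = ix4 by apply: val_inj.
  have hn p : box p0 r p -> hasd (fun p => a p * m p) p
      (- (m p * c p) * (a p * A1 p + B1 p)) (- (m p * c p) * (a p * A2 p + B2 p)).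
    move=> bp; have Dp := rD p (rr3 p bp); have ap := a0 Dp; have am := a1m Dp.
    have := hasdM (ha Dp) (hm p bp); apply: hasd_ext => //;
    by rewrite /weight_k /weight_c; field; rewrite ap am.
  exists (fun p => a p * m p), (fun=> 1); split; [by move=> p _; rewrite oner_neq0 orbT | | exact: cst |] => p bp;
    have [e1 e2] := w4 p (rD p (rr3 p bp)); rewrite e1 e2.
    by do 2 eexists; split; [exact: hn | ring].
  do 2 eexists; split; first exact: (hasdD (hasdM (hn p bp) (hu p bp)) (hasdM (hasd_cst 1 p) (hv p bp))).
  by rewrite -(mla p bp); ring.
Qed.

End WebAlgebra.

(** * Leaves and their images *)

Section Geometry.
Variables (R : realType) (F : numFieldType) (M : modulus R F).
Local Notation N := (mdl M).
Local Notation nm := (nm M).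
Local Notation box := (box M).
Implicit Types (p q r y z : pt F) (f g : pt F -> F) (U V W D : set (pt F)).
Implicit Types (X : foliation F) (w : form1 F).

Lemma chart_sym U V g1 g2 s1 s2 : chart U V g1 g2 s1 s2 -> chart V U s1 s2 g1 g2.
Proof. by case=> *; split. Qed.

Lemma continuous_image_connected U g1 g2 (C : set (pt F)) : C `<=` U ->
  (forall p, U p -> {for p, continuous g1}) -> (forall p, U p -> {for p, continuous g2}) ->
  connected C -> connected ((fun p => (g1 p, g2 p) : pt F) @` C).
Proof.
move=> CU c1 c2 cC; apply: connected_continuous_connected cC _.
apply: continuous_in_subspaceT => p; rewrite inE => /CU Up.
exact: (cvg_pair (c1 p Up) (c2 p Up)).
Qed.

(** One of the two coordinate functions completes [f] to a local chart: [snd] if [pd1 f p] is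
    nonzero, and [fst] otherwise. *)
Lemma straightening U f p : open U -> U p -> smooth U f -> dfun f p != 0 ->
  exists rho W g s1 s2, [/\ 0 < rho, W p, W `<=` U &
    chart W (box (f p, g p) rho) f g s1 s2].
Proof.
move=> oU Up sf df.
have [f1|f1] := eqVneq (pd1 f p) 0; last first.
  have [|rho [W [s1 [s2 [r0 Wp WU ch]]]]] :=
      inverse_function_theorem M oU Up sf (smooth_snd M oU).
    have [_ e1 e2] := hasd_diff (hasd_snd M p).
    by rewrite /jac e1 e2 mulr1 mulr0 subr0.
  by exists rho, W, snd, s1, s2.
have f2 : pd2 f p != 0.
  by apply: contra_neq df => f2; rewrite /dfun f1 f2.
have [|rho [W [s1 [s2 [r0 Wp WU ch]]]]] :=
    inverse_function_theorem M oU Up sf (smooth_fst M oU).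
  have [_ e1 e2] := hasd_diff (hasd_fst M p).
  by rewrite /jac e1 e2 mulr1 mulr0 sub0r oppr_eq0.
by exists rho, W, fst, s1, s2.
Qed.

(** In the chart the level set is a slice of a box at fixed first coordinate, which is convex. *)
Lemma level_connected W f g s1 s2 y0 rho q :
  chart W (box y0 rho) f g s1 s2 -> W q ->
  connected [set r | W r /\ f r = f q].
Proof.
move=> ch Wq; pose B : set (pt F) := [set y | box y0 rho y /\ y.1 = f q].
have -> : [set r | W r /\ f r = f q] = (fun y => (s1 y, s2 y) : pt F) @` B.
  apply/seteqP; split=> [r [Wr e]|_ [y [By e] <-]].
    exists (f r, g r); last exact: (chart_toK ch Wr).
    by split; [exact: (chart_to ch Wr) | ].
  split; first exact: (chart_from ch By).
  by rewrite -e; have /(congr1 fst) := chart_fromK ch By.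
apply: (continuous_image_connected (U := box y0 rho)).
- by move=> y [].
- by move=> y Vy; exact: smooth_continuous (chart_bwd1 ch) Vy.
- by move=> y Vy; exact: smooth_continuous (chart_bwd2 ch) Vy.
apply: (connected_convex (M := M)) => y z t [By ey] [Bz ez] ht.
split; first exact: box_segment.
by rewrite ptD1 ptZ1 ptB1 ey ez subrr mulr0 addr0.
Qed.

(** In the chart [f] is the first coordinate. [H] freezes that coordinate at [f q]; this makes it a
    function on the whole box with zero gradient, so that [constant_box] applies to it. *)
Lemma constant_on_levels W f g h s1 s2 y0 rho q r :
  chart W (box y0 rho) f g s1 s2 ->
  (forall p, W p -> dfun f p != 0) ->
  (forall p, W p -> exists P Q, hasd h p P Q /\ P * pd2 f p = Q * pd1 f p) ->
  W q -> W r -> f q = f r -> h q = h r.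
Proof.
move=> ch df hh Wq Wr e.
have oV : open (box y0 rho) := @open_box _ _ M y0 rho.
pose c := f q; pose H (z : pt F) := h (s1 (c, z.2), s2 (c, z.2)).
have Vq := chart_to ch Wq; have Vr := chart_to ch Wr.
have Vc z : box y0 rho z -> box y0 rho (c, z.2).
  move=> bz; move: Vq; rewrite /box /= !nm_lt => /andP[h1 _].
  by move: bz; rewrite /box /= nm_lt => /andP[_ h2]; rewrite h1.
have e1 : H (f q, g q) = h q.
  by rewrite /H /c /= (chart_toK ch Wq).
have e2 : H (f r, g r) = h r.
  by rewrite /H /c e /= (chart_toK ch Wr).
rewrite -e1 -e2; apply: (constant_box (M := M) (c := y0) (r := rho) _ Vq Vr) => z Vz.
have Vz' := Vc z Vz; set y := (c, z.2) in Vz'.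
have Wy := chart_from ch Vz'; set p := (s1 y, s2 y) in Wy.
have [P [Q [hP PQ]]] := hh p Wy.
have h1 := smooth_hasd (chart_bwd1 ch) Vz'; have h2 := smooth_hasd (chart_bwd2 ch) Vz'.
have hf : hasd (fun z => f (s1 z, s2 z)) y _ _ :=
  hasd_comp (smooth_hasd (chart_fwd1 ch) Wy) h1 h2.
have hf1 : hasd (fun z => f (s1 z, s2 z)) y 1 0.
  apply: (hasd_near M oV Vz' _ (hasd_fst M y)) => x Vx.
  by have /(congr1 fst) := chart_fromK ch Vx.
have [_ k2] := hasd_unique hf hf1.
have hG := hasd_comp hP h1 h2.
have hz := hasd_comp (f := fun z => h (s1 z, s2 z)) (g1 := fun=> c) hG (hasd_cst c z) (hasd_snd M z).
(* By [k2] the vector [(pd2 s1 y, pd2 s2 y)] is killed by [df], and [dh] is proportional to [df].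
   The proportionality is known only as a cross product, hence the multiplication by each partial
   derivative of [f], one of which is nonzero. *)
have G0 : P * pd2 s1 y + Q * pd2 s2 y = 0.
  have i1 : pd1 f p * (P * pd2 s1 y + Q * pd2 s2 y) = 0.
    transitivity (P * (pd1 f p * pd2 s1 y + pd2 f p * pd2 s2 y) +
      (Q * pd1 f p - P * pd2 f p) * pd2 s2 y); first by ring.
    by rewrite k2 PQ; ring.
  have i2 : pd2 f p * (P * pd2 s1 y + Q * pd2 s2 y) = 0.
    transitivity (Q * (pd1 f p * pd2 s1 y + pd2 f p * pd2 s2 y) +
      (P * pd2 f p - Q * pd1 f p) * pd2 s1 y); first by ring.
    by rewrite k2 PQ; ring.
  have [f1|f1] := eqVneq (pd1 f p) 0; last by apply: (mulfI f1); rewrite mulr0.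
  have [f2|f2] := eqVneq (pd2 f p) 0; last by apply: (mulfI f2); rewrite mulr0.
  by have := df p Wy; rewrite /dfun f1 f2 eqxx.
by apply: hasd_ext hz => //; rewrite /= G0; ring.
Qed.

(** The points of [C] where [f] equals [f q], and those where it differs, are covered by open sets
    on which this alternative does not change, so the first set is open and closed in [C]. *)
Lemma connected_constant (C : set (pt F)) f :
  (forall x, C x -> exists2 G : set (pt F), open G /\ G x & forall y, C y -> G y -> f y = f x) ->
  connected C -> forall q r, C q -> C r -> f q = f r.
Proof.
move=> loc cC q r Cq Cr.
pose good b (G : set (pt F)) := open G /\ forall y, C y -> G y -> (f y == f q) = b.
pose UU b := \bigcup_(G in [set G | good b G]) G.
have oUU b : open (UU b) by apply: bigcup_open => G [].
have cov x b : C x -> (f x == f q) = b -> UU b x.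
  move=> Cx fx; have [G [oG Gx] hG] := loc x Cx; exists G => //; split=> // y Cy Gy.
  by rewrite (hG y).
have : [set x | C x /\ f x = f q] = C.
  apply: cC; first by exists q.
    exists (UU true) => //; apply/seteqP; split=> x.
      by move=> [Cx fx]; split=> //; apply: cov => //; rewrite fx eqxx.
    by move=> [Cx [G [oG hG] Gx]]; split=> //; apply/eqP; rewrite hG.
  exists (~` UU false); first exact: open_closedC.
  apply/seteqP; split=> x.
    by move=> [Cx fx]; split=> // -[G [oG hG] Gx]; have := hG x Cx Gx; rewrite fx eqxx.
  move=> [Cx nU]; split=> //; apply: contrapT => /eqP fx; apply: nU.
  by apply: cov => //; exact: negbTE.
by move=> e; have : C r := Cr; rewrite -{1}e => -[_ ->].
Qed.

Lemma first_integral_form D X w U f p : defined_by D X w -> D p -> first_integral D X U f ->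
  U p -> pd1 f p * (w p).2 = pd2 f p * (w p).1.
Proof.
move=> [_ dw] Dp fi Up; have [_ h] := dw p Dp.
(* This vector spans the kernel of [df]. Being tangent to the leaf it is killed by [w], which is the
   proportionality of [df] and [w]. *)
pose v : pt F := (- pd2 f p, pd1 f p).
have /h : tangent D X p v.
  by exists U, f; split=> //; rewrite /ev /dfun /v /=; ring.
rewrite /ev /v /= => e; apply/eqP; rewrite -subr_eq0 -e; apply/eqP; ring.
Qed.

Lemma first_integral_sub D X U V f : open V -> V `<=` U -> first_integral D X U f ->
  first_integral D X V f.
Proof.
move=> oV VU [oU UD sf df hX]; split=> //.
- by move=> p /VU /UD.
- exact: smooth_sub VU sf.
- by move=> p /VU; exact: df.
- by move=> p q /VU Up /VU Uq; exact: hX.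
Qed.

(* Around each point of [U] the foliation is a fibration of a box with connected
   plaques, so that a plaque lies in a single leaf of the restriction to [U]. *)
Lemma plaque D X U p : is_foliation D X -> open U -> U `<=` D -> U p ->
  exists W f, [/\ W p, W `<=` U, first_integral D X W f,
    (forall q r, W q -> W r -> X q r -> Defs.restrict U X q r) &
    forall h, (forall x, W x -> exists P Q, hasd h x P Q /\ P * pd2 f x = Q * pd1 f x) ->
      forall q r, W q -> W r -> X q r -> h q = h r].
Proof.
move=> fX oU UD Up.
have [U' [f [U'p fi]]] := fol_loc fX (UD p Up).
have [oU' U'D sf df hX] := fi.
have oI : open (U' `&` U) by exact: openI.
have [rho [W [g [s1 [s2 [r0 Wp WI ch]]]]]] :=
  straightening oI (conj U'p Up) (smooth_sub (@subIsetl _ _ _) sf) (df p U'p).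
have WU' : W `<=` U' by move=> x /WI[].
have WU : W `<=` U by move=> x /WI[].
exists W, f; split=> //.
- exact: first_integral_sub (chart_open1 ch) WU' fi.
- move=> q r Wq Wr /(hX q r (WU' q Wq) (WU' r Wr)).1 e.
  have := level_connected ch Wq; set L := [set _ | _] => cL.
  have LX : L `<=` X q `&` U.
    move=> x [Wx ex]; split; last exact: WU.
    by apply/(hX q x (WU' q Wq) (WU' x Wx)).
  have Lq : L q by [].
  by apply: (connected_component_max Lq LX cL); split.
- move=> h hh q r Wq Wr /(hX q r (WU' q Wq) (WU' r Wr)).1 e.
  by apply: (constant_on_levels ch) e => // x /WU' /df.
Qed.

(** Both [dh] and the differential of a local first integral are proportional to the nonvanishing
    form [w], hence to each other, so [h] is constant on plaques. The leaf of the restriction is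
    connected, and [connected_constant] passes from plaques to the leaf. *)
Lemma leaf_constant D X w U p h : is_foliation D X -> defined_by D X w -> open U -> U `<=` D ->
  U p -> along U w h -> forall q r, Defs.restrict U X p q -> Defs.restrict U X p r -> h q = h r.
Proof.
move=> fX dw oU UD Up hh.
have sub x : Defs.restrict U X p x -> X p x /\ U x.
  by move=> /connected_component_sub[].
apply: connected_constant; last exact: component_connected.
move=> x Cx; have [Xx Ux] := sub x Cx.
have [W [f [Wx WU fi _ hW]]] := plaque fX oU UD Ux.
have [oW WD _ _ _] := fi.
exists W => // y Cy Wy; have [Xy Uy] := sub y Cy.
have e := fol_part fX (UD p Up) Xx.
apply/esym; apply: (hW h _ x y Wx Wy); last by rewrite e.
move=> z Wz; have [P [Q [hPQ PQ]]] := hh z (WU z Wz); exists P, Q; split=> //.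
have := first_integral_form dw (WD z Wz) fi Wz.
have [w0 _] := dw.2 z (WD z Wz).
move: PQ w0; case: (w z) => w1 w2 /= PQ w0 ff.
have i1 : w1 * (P * pd2 f z - Q * pd1 f z) = 0.
  transitivity (P * (pd2 f z * w1) - pd1 f z * (Q * w1)); first by ring.
  by rewrite -PQ -ff; ring.
have i2 : w2 * (P * pd2 f z - Q * pd1 f z) = 0.
  transitivity ((P * w2) * pd2 f z - Q * (pd1 f z * w2)); first by ring.
  by rewrite PQ ff; ring.
apply/eqP; rewrite -subr_eq0; apply/eqP.
have [w10|w10] := eqVneq w1 0; last by apply: (mulfI w10); rewrite mulr0.
have [w20|w20] := eqVneq w2 0; last by apply: (mulfI w20); rewrite mulr0.
by move: w0; rewrite w10 w20 eqxx.
Qed.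

End Geometry.

(** * The web carried over by a chart *)

Section Transport.
Variables (R : realType) (F : numFieldType) (M : modulus R F).
Local Notation box := (box M).
Implicit Types (p q r y z v : pt F) (f : pt F -> F) (U V W D : set (pt F)).

(* [f = f' \o g] near [p] when [f' = f \o s], so the gradients vanish together. *)
Lemma chart_gradient U V g1 g2 s1 s2 W f y :
  chart U V g1 g2 s1 s2 -> open W -> W `<=` U -> smooth W f -> V y -> W (s1 y, s2 y) ->
  dfun f (s1 y, s2 y) != 0 -> dfun (fun z => f (s1 z, s2 z)) y != 0.
Proof.
move=> ch oW WU sf Vy Wy; set p := (s1 y, s2 y) in Wy *; apply: contraNneq => df.
pose f' z := f (s1 z, s2 z).
have Up : U p := WU p Wy.
have e : y = (g1 p, g2 p) by rewrite (chart_fromK ch Vy).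
have hf' : hasd f' y (pd1 f' y) (pd2 f' y).
  apply: diff_hasd; have [] := hasd_diff (hasd_comp (smooth_hasd sf Wy)
    (smooth_hasd (chart_bwd1 ch) Vy) (smooth_hasd (chart_bwd2 ch) Vy)); exact.
move: df hf'; rewrite /dfun => -[-> ->]; rewrite e => hf'.
have h := hasd_comp hf' (smooth_hasd (chart_fwd1 ch) Up) (smooth_hasd (chart_fwd2 ch) Up).
have h2 : hasd f p 0 0.
  apply: (hasd_near M oW Wy (f := fun q => f' (g1 q, g2 q))).
    by move=> q Wq; rewrite /f' (chart_toK ch (WU q Wq)).
  by apply: hasd_ext h => //; ring.
by have [_ -> ->] := hasd_diff h2.
Qed.

Variables (D U V : set (pt F)) (X : web F) (g1 g2 s1 s2 : pt F -> F).
Hypotheses (wX : is_web D X) (UD : U `<=` D) (ch : chart U V g1 g2 s1 s2).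
Hypothesis cV : connected V.

Let phi p : pt F := (g1 p, g2 p).
Let psi y : pt F := (s1 y, s2 y).

Definition image_web : web F := fun c y => phi @` Defs.restrict U (X c) (psi y).
Local Notation Y := image_web.

Let phiK p : U p -> psi (phi p) = p. Proof. exact: (chart_toK ch). Qed.
Let psiK y : V y -> phi (psi y) = y. Proof. exact: (chart_fromK ch). Qed.
Let phiV p : U p -> V (phi p). Proof. exact: (chart_to ch). Qed.
Let psiU y : V y -> U (psi y). Proof. exact: (chart_from ch). Qed.
Let oU : open U. Proof. exact: chart_open1 ch. Qed.
Let oV : open V. Proof. exact: chart_open2 ch. Qed.

Lemma restrictP c p q : Defs.restrict U (X c) p q -> X c p q /\ U q.
Proof. by move=> /connected_component_sub[]. Qed.

Lemma restrict_refl c p : U p -> Defs.restrict U (X c) p p.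
Proof.
move=> Up; apply: connected_component_refl; split=> //.
exact: (fol_refl (web_fol wX c) (UD Up)).
Qed.

Lemma image_webP c y z : V y -> V z ->
  Y c y z <-> Defs.restrict U (X c) (psi y) (psi z).
Proof.
move=> Vy Vz; split; last by exists (psi z) => //; exact: psiK.
by move=> [q hq <-]; have [_ Uq] := restrictP hq; rewrite phiK.
Qed.

Lemma image_web_sub c y z : V y -> Y c y z -> V z.
Proof. by move=> Vy [q /restrictP[_ Uq] <-]; exact: phiV. Qed.

Lemma image_web_restrict c y z : V y -> Y c y z ->
  V z /\ Defs.restrict U (X c) (psi y) (psi z).
Proof.
by move=> Vy Yz; have Vz := image_web_sub Vy Yz; split=> //; apply/image_webP.
Qed.

Lemma open_psi W : open W -> open [set z | V z /\ W (psi z)].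
Proof.
move=> oW; apply: (open_preimage M oV oW) => z Vz.
  exact: smooth_continuous (chart_bwd1 ch) Vz.
exact: smooth_continuous (chart_bwd2 ch) Vz.
Qed.

Lemma open_phi W : open W -> open [set p | U p /\ W (phi p)].
Proof.
move=> oW; apply: (open_preimage M oU oW) => z Vz.
  exact: smooth_continuous (chart_fwd1 ch) Vz.
exact: smooth_continuous (chart_fwd2 ch) Vz.
Qed.

(** The local first integral is [f] composed with [psi]. A leaf of [X c] may meet [U] in several
    components, so the neighbourhood is taken from [plaque]: there, points on one leaf of [X c] are
    also on one leaf of the restriction, as the level sets require. *)
Lemma image_web_foliation c : is_foliation V (Y c).
Proof.
split.
- by move=> y Vy z; exact: image_web_sub.
- by move=> y Vy; apply/image_webP => //; exact: restrict_refl (psiU Vy).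
- move=> y z Vy /(image_web_restrict Vy)[Vz hyz]; rewrite /Y /image_web; congr (phi @` _).
  have [Xz _] := restrictP hyz.
  rewrite /Defs.restrict (fol_part (web_fol wX c) (UD (psiU Vy)) Xz).
  by apply/esym; exact: same_connected_component.
- move=> y Vy; apply: (continuous_image_connected (U := U)).
  + by move=> q /restrictP[].
  + by move=> p Up; exact: smooth_continuous (chart_fwd1 ch) Up.
  + by move=> p Up; exact: smooth_continuous (chart_fwd2 ch) Up.
  + exact: component_connected.
move=> y Vy; have [W [f [Wy WU fi hW _]]] := plaque M (web_fol wX c) oU UD (psiU Vy).
have [oW WD sf df hX] := fi.
pose G : set (pt F) := [set z | V z /\ W (psi z)].
have oG : open G by exact: open_psi.
exists G, (fun z => f (psi z)); split; first by split.
split=> //.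
- by move=> z [].
- have GV : G `<=` V by move=> z [].
  have GW z : G z -> W (s1 z, s2 z) by move=> [].
  exact (smooth_comp M oG oW GW sf (smooth_sub GV (chart_bwd1 ch)) (smooth_sub GV (chart_bwd2 ch))).
- by move=> z [Vz Wz]; apply: (chart_gradient ch oW WU sf Vz Wz (df _ Wz)).
- move=> z z' [Vz Wz] [Vz' Wz']; split.
    by move=> /(image_webP c Vz Vz')/restrictP[/(hX _ _ Wz Wz')].
  by move=> /(hX _ _ Wz Wz') Xz; apply/(image_webP c Vz Vz'); exact: hW.
Qed.

(** The vector on the right is the image of [v] under the differential of [psi]. A first integral of
    the image web, composed with [phi], becomes one of [X c] itself once its domain is cut down to a
    plaque neighbourhood. *)
Lemma image_web_tangent c y v : V y -> tangent V (Y c) y v ->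
  tangent D (X c) (psi y) (lin2 (pd1 s1 y) (pd2 s1 y) v, lin2 (pd1 s2 y) (pd2 s2 y) v).
Proof.
move=> Vy [V' [f [V'y [oV' V'V sf df hY] fv]]].
have [W [f0 [Wy WU fi hW _]]] := plaque M (web_fol wX c) oU UD (psiU Vy).
have [oW WD _ _ _] := fi.
pose G : set (pt F) := W `&` [set p | U p /\ V' (phi p)].
have oG : open G by apply: openI => //; exact: open_phi.
have GU : G `<=` U by move=> p [_ []].
have GV' p : G p -> V' (g1 p, g2 p) by move=> [_ []].
pose h p := f (g1 p, g2 p).
have sh : smooth G h.
  exact (smooth_comp M oG oV' GV' sf (smooth_sub GU (chart_fwd1 ch)) (smooth_sub GU (chart_fwd2 ch))).
have Gy : G (psi y) by split=> //; split; [exact: psiU | rewrite psiK].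
exists G, h; split=> //.
  split=> //.
  - by move=> p [/WD].
  - move=> p Gp; apply: (chart_gradient (chart_sym ch) oV' V'V sf (GU p Gp) (GV' p Gp)).
    exact: df (GV' p Gp).
  - move=> p q [Wp [Up Vp]] [Wq [Uq Vq]]; rewrite /h -(hY _ _ Vp Vq).
    rewrite (image_webP c (V'V _ Vp) (V'V _ Vq)) !phiK //; split; first exact: hW.
    by move=> /restrictP[].
have hc := hasd_comp (smooth_hasd sh Gy) (smooth_hasd (chart_bwd1 ch) Vy)
  (smooth_hasd (chart_bwd2 ch) Vy).
have hf : hasd (fun z => h (s1 z, s2 z)) y (pd1 f y) (pd2 f y).
  apply: (hasd_near M oV' V'y _ (smooth_hasd sf V'y)) => z /V'V Vz.
  by rewrite /h -[(g1 _, g2 _)]/(phi (psi z)) psiK.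
have [e1 e2] := hasd_unique hc hf.
rewrite -fv /ev /dfun /= -e1 -e2 /lin2 /psi; ring.
Qed.

Lemma image_web_is_web : is_web V Y.
Proof.
split=> //; first exact: image_web_foliation.
- move=> c c' y v cc Vy /(image_web_tangent Vy) t1 /(image_web_tangent Vy) t2.
  have := web_tangent wX cc (UD (psiU Vy)) t1 t2 => -[e1 e2].
  have Up := psiU Vy.
  (* The chain rule for [phi] after [psi] recovers [v] from its image under the differential of
     [psi], which has just been shown to be zero. *)
  have h1 := hasd_comp (smooth_hasd (chart_fwd1 ch) Up) (smooth_hasd (chart_bwd1 ch) Vy)
    (smooth_hasd (chart_bwd2 ch) Vy).
  have h2 := hasd_comp (smooth_hasd (chart_fwd2 ch) Up) (smooth_hasd (chart_bwd1 ch) Vy)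
    (smooth_hasd (chart_bwd2 ch) Vy).
  have [a1 a2] := hasd_unique h1 (hasd_near M oV Vy (fun z Vz => esym (congr1 fst (psiK Vz)))
    (hasd_fst M y)).
  have [b1 b2] := hasd_unique h2 (hasd_near M oV Vy (fun z Vz => esym (congr1 snd (psiK Vz)))
    (hasd_snd M y)).
  have id1 : v.1 = lin2 (pd1 g1 (psi y)) (pd2 g1 (psi y))
      (lin2 (pd1 s1 y) (pd2 s1 y) v, lin2 (pd1 s2 y) (pd2 s2 y) v).
    transitivity (1 * v.1 + 0 * v.2); first by ring.
    by rewrite -a1 -a2 /lin2 /=; ring.
  have id2 : v.2 = lin2 (pd1 g2 (psi y)) (pd2 g2 (psi y))
      (lin2 (pd1 s1 y) (pd2 s1 y) v, lin2 (pd1 s2 y) (pd2 s2 y) v).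
    transitivity (0 * v.1 + 1 * v.2); first by ring.
    by rewrite -b1 -b2 /lin2 /=; ring.
  by apply: pt_eq; rewrite ?id1 ?id2 e1 e2 /lin2 /= !mulr0 addr0.
- move=> c c' y z r s cc Vy Vz [h1 h2] [h3 h4].
  have [Vr /restrictP[k1 _]] := image_web_restrict Vy h1.
  have [_ /restrictP[k2 _]] := image_web_restrict Vz h2.
  have [Vs /restrictP[k3 _]] := image_web_restrict Vy h3.
  have [_ /restrictP[k4 _]] := image_web_restrict Vz h4.
  rewrite -(psiK Vr) -(psiK Vs); congr phi.
  exact: (web_inter wX cc (UD (psiU Vy)) (UD (psiU Vz)) (conj k1 k2) (conj k3 k4)).
Qed.

Lemma image_web_equivalent : equivalent U (restrict_web U X) V Y.
Proof.
exists phi; split.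
  exists psi; split.
  + by split; [exact: chart_fwd1 ch | exact: chart_fwd2 ch].
  + by split; [exact: chart_bwd1 ch | exact: chart_bwd2 ch].
  + by split.
  + exact: phiK.
  + exact: psiK.
by move=> c p Up; rewrite /Y /image_web phiK.
Qed.

Lemma image_web_linear d : is_web_data D X d ->
  (forall i : 'I_4, exists al be : pt F -> F,
    [/\ forall p, U p -> (al p != 0) || (be p != 0),
        along U (omega d i) al, along U (omega d i) be &
        along U (omega d i) (fun p => al p * g1 p + be p * g2 p)]) ->
  linear_web V Y.
Proof.
move=> wd hl c y Vy; have [al [be [nz h1 h2 h3]]] := hl c.
have Up := psiU Vy; set p := psi y in Up.
have cst h (ha : along U (omega d c) h) q : Defs.restrict U (X c) p q -> h q = h p.
  move=> hq; exact (leaf_constant M (web_fol wX c) (wd_forms wd c) oU UD Up ha hq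
    (restrict_refl c Up)).
(* Direction vector of the line [al p * x + be p * y = const]. *)
pose v : pt F := (- be p, al p).
have v0 : v != 0.
  apply/eqP => -[/eqP]; rewrite oppr_eq0 => /eqP b0 a0.
  by have := nz p Up; rewrite a0 b0 eqxx.
exists [set y + t *: v | t in [set: F]]; split; first by exists y, v.
move=> _ [q hq <-].
have e1 := cst _ h1 q hq; have e2 := cst _ h2 q hq; have := cst _ h3 q hq.
rewrite /= e1 e2 => e3.
have ey : y = phi p by rewrite psiK.
have e4 : al p * (g1 q - g1 p) + be p * (g2 q - g2 p) = 0.
  transitivity ((al p * g1 q + be p * g2 q) - (al p * g1 p + be p * g2 p)); first by ring.
  by rewrite e3 subrr.
(* The parameter of the point on the line is read off from a coordinate in which [v] does not
   vanish. *)
have [a0|a0] := eqVneq (al p) 0.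
  have b0 : be p != 0 by have := nz p Up; rewrite a0 eqxx.
  exists (- (g1 q - g1 p) / be p) => //; rewrite ey; apply: pt_eq.
    by rewrite ptD1 ptZ1 /v /=; field.
  move: e4; rewrite a0 mul0r add0r => /eqP; rewrite mulf_eq0 (negbTE b0) orFb subr_eq0 => /eqP e4.
  by rewrite ptD2 ptZ2 /v /= a0 mulr0 addr0 e4.
exists ((g2 q - g2 p) / al p) => //; rewrite ey; apply: pt_eq.
  rewrite ptD1 ptZ1 /v /=.
  have -> : g1 p + (g2 q - g2 p) / al p * - be p =
    g1 q - (al p * (g1 q - g1 p) + be p * (g2 q - g2 p)) / al p by field.
  by rewrite e4 mul0r subr0.
by rewrite ptD2 ptZ2 /v /=; field.
Qed.

End Transport.

Section Linearization.
Variables (R : realType) (F : numFieldType) (M : modulus R F).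

(** If the product vanished, the vector spanning the kernel of [omega_1] would also be killed by
    [omega_2], a common tangent of two foliations of the web. *)
Lemma wedge_neq0 (D : set (pt F)) (X : web F) d p : is_web D X -> is_web_data D X d -> D p ->
  wedge (omega d ix1) (omega d ix2) p != 0.
Proof.
move=> wX wd Dp; apply/eqP => W0.
have [w10 t1] := (wd_forms wd ix1).2 p Dp; have [_ t2] := (wd_forms wd ix2).2 p Dp.
pose v : pt F := (- (omega d ix1 p).2, (omega d ix1 p).1).
have h1 : tangent D (X ix1) p v by apply/t1; rewrite /ev /v /=; ring.
have h2 : tangent D (X ix2) p v.
  by apply/t2; rewrite -W0 /ev /v /wedge /=; ring.
have := web_tangent wX (isT : ix1 != ix2) Dp h1 h2 => -[/eqP].
rewrite oppr_eq0 => /eqP e2 e1; move: w10.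
by rewrite (surjective_pairing (omega d ix1 p)) e1 e2 eqxx.
Qed.

Theorem MW_locally_linearizable (D : set (pt F)) (X : web F) :
  is_MW D X -> locally_linearizable D X.
Proof.
move=> [wX [d [wd nc ec]]] p Dp.
have W0 q : D q -> wedge (omega d ix1) (omega d ix2) q != 0 := wedge_neq0 wX wd.
have [r [u [v [[r0 rD su sv] [juv lines]]]]] := linear_coordinates M (web_open wX) wd nc ec W0 Dp.
have bp := box_center M p r0; have oB : open (box M p r) := @open_box _ _ M p r.
have [rho [U [s1 [s2 [rho0 Up UB ch]]]]] := inverse_function_theorem M oB bp su sv (juv p bp).
have UD : U `<=` D by move=> q /UB /rD.
have oU := chart_open1 ch.
exists U; split=> //.
  (* The chart domain is connected because it is the image of a box under the inverse chart. *)
  have -> : U = (fun y => (s1 y, s2 y) : pt F) @` box M (u p, v p) rho.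
    apply/seteqP; split=> [q Uq|_ [y Vy <-]]; last exact: (chart_from ch Vy).
    by exists (u q, v q); [exact: (chart_to ch Uq) | exact: (chart_toK ch Uq)].
  apply: (continuous_image_connected (U := box M (u p, v p) rho)) => //.
  - by move=> y Vy; exact: smooth_continuous (chart_bwd1 ch) Vy.
  - by move=> y Vy; exact: smooth_continuous (chart_bwd2 ch) Vy.
  exact: connected_box.
have cV : connected (box M (u p, v p) rho) by exact: connected_box.
exists (box M (u p, v p) rho), (image_web U X u v s1 s2); split.
- exact (image_web_is_web M wX UD ch cV).
- apply: (image_web_linear M wX UD ch wd) => i.
  have [al [be [nz h1 h2 h3]]] := lines i; exists al, be; split.
  + by move=> q /UB; exact: nz.
  + by move=> q /UB; exact: h1.
  + by move=> q /UB; exact: h2.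
  + by move=> q /UB; exact: h3.
- exact (image_web_equivalent X ch).
Qed.

End Linearization.

(** * The real and complex cases *)

Section RealModulus.
Variable R : realType.

Lemma real_cauchy_cvg (u : nat -> R) :
  (forall e, 0 < e -> exists k, forall m n, (k <= m)%N -> (k <= n)%N -> `|u m - u n| < e) ->
  exists l, forall e, 0 < e -> exists k, forall n, (k <= n)%N -> `|u n - l| < e.
Proof.
move=> h.
have /cvg_ex[l hl] : cvg (u @ \oo).
  apply: cauchy_cvg; apply: cauchy_exP => e e0; have [k hk] := h e e0.
  exists (u k); exists k => // n /= kn; rewrite -ball_normE /ball_ /=; exact: hk.
exists l => e e0; have /cvgrPdist_lt/(_ e e0)[k _ hk] := hl.
by exists k => n kn; rewrite distrC; exact: hk.
Qed.

Definition real_modulus : modulus R R :=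
  @Modulus R R idfun Num.norm (fun=> erefl) (fun _ _ => erefl) real_cauchy_cvg.

Lemma complex_norm_normc (z : R[i]) : `|z| = real_complex R (Normc.normc z).
Proof. by []. Qed.

Lemma normc_ReIm (z : R[i]) : Normc.normc z <= `|complex.Re z| + `|complex.Im z|.
Proof.
case: z => a b /=; rewrite -(ler_pXn2r (_ : 0 < 2)%N) ?nnegrE ?sqrtr_ge0 ?addr_ge0 //.
rewrite sqr_sqrtr ?addr_ge0 ?sqr_ge0 // sqrrD !real_normK ?num_real //.
by rewrite addrAC lerDl mulrn_wge0 // mulr_ge0.
Qed.

Lemma Re_normc (z : R[i]) : `|complex.Re z| <= Normc.normc z.
Proof.
by case: z => a b /=; rewrite -sqrtr_sqr ler_sqrt ?addr_ge0 ?sqr_ge0 // lerDl sqr_ge0.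
Qed.

Lemma Im_normc (z : R[i]) : `|complex.Im z| <= Normc.normc z.
Proof.
by case: z => a b /=; rewrite -sqrtr_sqr ler_sqrt ?addr_ge0 ?sqr_ge0 // lerDr sqr_ge0.
Qed.

Lemma complex_ReB (z w : R[i]) : complex.Re (z - w) = complex.Re z - complex.Re w.
Proof. by case: z w => a b []. Qed.

Lemma complex_ImB (z w : R[i]) : complex.Im (z - w) = complex.Im z - complex.Im w.
Proof. by case: z w => a b []. Qed.

Lemma complex_cauchy_cvg (u : nat -> R[i]) :
  (forall e, 0 < e -> exists k, forall m n, (k <= m)%N -> (k <= n)%N ->
     Normc.normc (u m - u n) < e) ->
  exists l, forall e, 0 < e -> exists k, forall n, (k <= n)%N -> Normc.normc (u n - l) < e.
Proof.
move=> h.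
have [x hx] : exists l, forall e, 0 < e -> exists k, forall n, (k <= n)%N -> `|complex.Re (u n) - l| < e.
  apply: real_cauchy_cvg => e /h[k hk]; exists k => m n km kn.
  by rewrite -complex_ReB; apply: le_lt_trans (Re_normc _) (hk m n km kn).
have [y hy] : exists l, forall e, 0 < e -> exists k, forall n, (k <= n)%N -> `|complex.Im (u n) - l| < e.
  apply: real_cauchy_cvg => e /h[k hk]; exists k => m n km kn.
  by rewrite -complex_ImB; apply: le_lt_trans (Im_normc _) (hk m n km kn).
exists (Complex x y) => e e0; have e2 : 0 < e / 2 by lra.
have [k1 h1] := hx _ e2; have [k2 h2] := hy _ e2.
exists (maxn k1 k2) => n; rewrite geq_max => /andP[/h1 i1 /h2 i2].
apply: le_lt_trans (normc_ReIm _) _; rewrite complex_ReB complex_ImB /=; lra.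
Qed.

Definition complex_modulus : modulus R R[i] :=
  @Modulus R R[i] (real_complex R) (@Normc.normc R) complex_norm_normc (@lecR R) complex_cauchy_cvg.

End RealModulus.

Theorem theorem10 (R : realType) :
  (forall (D : set (pt R)) (X : web R),
     is_MW D X -> locally_linearizable D X) /\
  (forall (D : set (pt R[i])) (X : web R[i]),
     is_MW D X -> locally_linearizable D X).
Proof.
split=> D X; first exact (@MW_locally_linearizable _ _ (real_modulus R) D X).
exact (@MW_locally_linearizable _ _ (complex_modulus R) D X).
Qed.
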